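(* Let $$f=x_1^2+(x_2-3x_3)^3+x_3^6\in\mathbb{C}\{x_1,x_2,x_3\},$$ and let $D=\{f=0\}\subset(\mathbb{C}^3,0)$. Then $D$ is a reduced isolated hypersurface singularity and is weighted homogeneous after the linear coordinate change $u=x_1$, $v=x_2-3x_3$, $w=x_3$. However, in the $x$-coordinates, there is no logarithmic vector field germ $V=\sum_{i=1}^{3}\nu_i\frac{\partial}{\partial x_i}\in\operatorname{Der}(-\log D)$ satisfying $$2\operatorname{Re}\left(\sum_{i=1}^{3}\nu_i(P)\overline{P_i}\right)\neq0$$ for all points $P$ on all sufficiently small standard round links $D\cap S_\epsilon$ of $D$.
   Context: $\mathbb{C}\{x_1,x_2,x_3\}$ is the ring of convergent power series. A holomorphic vector field germ $V=\sum_i\nu_i\,\partial/\partial x_i$ at $0\in\mathbb{C}^3$ is logarithmic along $D=\{f=0\}$, written $V\in\operatorname{Der}(-\log D)$, if $V(f)=hf$ for some holomorphic germ $h$ at $0$ (equivalently, $V$ is tangent to the smooth locus of $D$, as $f$ is reduced). $S_\epsilon=\{P\in\mathbb{C}^3: |P_1|^2+|P_2|^2+|P_3|^2=\epsilon^2\}$ is the standard round sphere in the $x$-coordinates. An isolated hypersurface singularity is one whose singular locus near $0$ is $\{0\}$. Weighted homogeneous in given coordinates $y_1,y_2,y_3$ means that there are positive real numbers $w_i$ and $d$ with $\sum_i w_iy_i\,\partial f/\partial y_i=d f$ for the defining equation $f$. *)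

(* Defs.v *)
From Stdlib Require Import Reals.
From Coquelicot Require Import Coquelicot.

Open Scope R_scope.

(** * Power series in three variables *)

(** [a i j k] is the coefficient of [x1^i x2^j x3^k]. *)
Definition ps3 := nat -> nat -> nat -> C.

Declare Scope ps3_scope.
Delimit Scope ps3_scope with ps.
Bind Scope ps3_scope with ps3.

(** The sum of [t i j k] over the (finitely many) triples with [i + j + k = n]. *)
Definition sum_deg {G : AbelianMonoid} (t : nat -> nat -> nat -> G) (n : nat) : G :=
  sum_n (fun i => sum_n (fun j => t i j (n - i - j)%nat) (n - i)) n.

Definition ps_eq (a b : ps3) : Prop := forall i j k, a i j k = b i j k.

Definition ps_monomial (p q s : nat) : ps3 := fun i j k =>
  if andb (Nat.eqb i p) (andb (Nat.eqb j q) (Nat.eqb k s)) then RtoC 1 else RtoC 0.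

Definition ps_one : ps3 := ps_monomial 0 0 0.
Definition X1 : ps3 := ps_monomial 1 0 0.
Definition X2 : ps3 := ps_monomial 0 1 0.
Definition X3 : ps3 := ps_monomial 0 0 1.

Definition ps_add (a b : ps3) : ps3 := fun i j k => (a i j k + b i j k)%C.
Definition ps_sub (a b : ps3) : ps3 := fun i j k => (a i j k - b i j k)%C.
Definition ps_scal (c : C) (a : ps3) : ps3 := fun i j k => (c * a i j k)%C.

Definition ps_mul (a b : ps3) : ps3 := fun i j k =>
  sum_n (fun p => sum_n (fun q => sum_n (fun s =>
    (a p q s * b (i - p)%nat (j - q)%nat (k - s)%nat)%C) k) j) i.

Fixpoint ps_pow (a : ps3) (n : nat) : ps3 :=
  match n with
  | O => ps_one
  | S m => ps_mul a (ps_pow a m)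
  end.

Notation "a == b" := (ps_eq a b) (at level 70, no associativity) : ps3_scope.
Notation "a + b" := (ps_add a b) : ps3_scope.
Notation "a - b" := (ps_sub a b) : ps3_scope.
Notation "a * b" := (ps_mul a b) : ps3_scope.
Notation "c *: a" := (ps_scal c a) (at level 40, left associativity) : ps3_scope.
Notation "a ^ n" := (ps_pow a n) : ps3_scope.

Definition ps_d1 (a : ps3) : ps3 := fun i j k => (INR (S i) * a (S i) j k)%C.
Definition ps_d2 (a : ps3) : ps3 := fun i j k => (INR (S j) * a i (S j) k)%C.
Definition ps_d3 (a : ps3) : ps3 := fun i j k => (INR (S k) * a i j (S k))%C.

(** The substitution [a(y1, y2, y3)].  It is meaningful when the [yi] have zero
    constant term: then [y1^i y2^j y3^k] has no terms of degree less than
    [i + j + k], so its coefficient at [(p, q, s)] vanishes unless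
    [i + j + k <= p + q + s]. *)
Definition ps_comp (a y1 y2 y3 : ps3) : ps3 := fun p q s =>
  sum_n (sum_deg (fun i j k => (a i j k * (y1 ^ i * y2 ^ j * y3 ^ k)%ps p q s)%C))
        (p + q + s)%nat.

(** Membership in the ring of convergent power series: [sum |a_ijk| r^(i+j+k)]
    is finite for some [r > 0]. *)
Definition convergent (a : ps3) : Prop :=
  exists r : R, 0 < r /\
    ex_series (sum_deg (fun i j k => Cmod (a i j k) * r ^ (i + j + k))).

(** The value at [P] of the germ with power series [a].  [Series] is a total
    function on real sequences; for convergent [a] this is the sum of the
    series as soon as [P] is close enough to 0. *)
Definition ps_eval (a : ps3) (P : C * C * C) : C :=
  let '(P1, P2, P3) := P in
  let u := sum_deg (fun i j k => (a i j k * (P1 ^ i * P2 ^ j * P3 ^ k))%C) in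
  (Series (fun n => Re (u n)), Series (fun n => Im (u n))).

(** * The hypersurface germ defined by f *)

Definition norm_sq (P : C * C * C) : R :=
  let '(P1, P2, P3) := P in (Cmod P1) ^ 2 + (Cmod P2) ^ 2 + (Cmod P3) ^ 2.

Definition sphere (eps : R) (P : C * C * C) : Prop := norm_sq P = eps ^ 2.

Definition hypersurface (f : ps3) (P : C * C * C) : Prop := ps_eval f P = RtoC 0.

Definition in_ideal (f g : ps3) : Prop :=
  exists q : ps3, convergent q /\ (g == q * f)%ps.

(** The local ring of the germ [{f = 0}], i.e. convergent power series modulo
    [f], has no nonzero nilpotent element. *)
Definition reduced (f : ps3) : Prop :=
  forall (g : ps3) (n : nat),
    convergent g -> in_ideal f (g ^ n)%ps -> in_ideal f g.

(** The singular locus of a reduced hypersurface [{f = 0}]. *)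
Definition singular_point (f : ps3) (P : C * C * C) : Prop :=
  hypersurface f P /\
  ps_eval (ps_d1 f) P = RtoC 0 /\
  ps_eval (ps_d2 f) P = RtoC 0 /\
  ps_eval (ps_d3 f) P = RtoC 0.

Definition isolated_singularity (f : ps3) : Prop :=
  exists eps : R, 0 < eps /\
    forall P : C * C * C, norm_sq P < eps ^ 2 ->
      (singular_point f P <-> P = (RtoC 0, RtoC 0, RtoC 0)).

(** * Weighted homogeneity *)

Definition weighted_homogeneous (f : ps3) : Prop :=
  exists w1 w2 w3 d : R, 0 < w1 /\ 0 < w2 /\ 0 < w3 /\ 0 < d /\
    (RtoC w1 *: (X1 * ps_d1 f) + RtoC w2 *: (X2 * ps_d2 f)
       + RtoC w3 *: (X3 * ps_d3 f) == RtoC d *: f)%ps.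

(** [(y1, y2, y3)] is a system of local holomorphic coordinates at 0, centred
    at 0: the Jacobian determinant does not vanish at 0. *)
Definition coordinates (y1 y2 y3 : ps3) : Prop :=
  convergent y1 /\ convergent y2 /\ convergent y3 /\
  y1 0%nat 0%nat 0%nat = RtoC 0 /\
  y2 0%nat 0%nat 0%nat = RtoC 0 /\
  y3 0%nat 0%nat 0%nat = RtoC 0 /\
  (ps_d1 y1 * (ps_d2 y2 * ps_d3 y3 - ps_d3 y2 * ps_d2 y3)
   - ps_d2 y1 * (ps_d1 y2 * ps_d3 y3 - ps_d3 y2 * ps_d1 y3)
   + ps_d3 y1 * (ps_d1 y2 * ps_d2 y3 - ps_d2 y2 * ps_d1 y3))%ps
    0%nat 0%nat 0%nat <> RtoC 0.

(** [F] is the expression of [f] in the coordinates [(y1, y2, y3)]. *)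
Definition weighted_homogeneous_in (y1 y2 y3 f : ps3) : Prop :=
  coordinates y1 y2 y3 /\
  exists F : ps3, convergent F /\ (f == ps_comp F y1 y2 y3)%ps /\
    weighted_homogeneous F.

(** * Logarithmic vector fields *)

(** [nu1 d/dx1 + nu2 d/dx2 + nu3 d/dx3] is a holomorphic vector field germ in
    [Der(-log {f = 0})]. *)
Definition logarithmic (f nu1 nu2 nu3 : ps3) : Prop :=
  convergent nu1 /\ convergent nu2 /\ convergent nu3 /\
  exists h : ps3, convergent h /\
    (nu1 * ps_d1 f + nu2 * ps_d2 f + nu3 * ps_d3 f == h * f)%ps.

Definition radial_product (nu1 nu2 nu3 : ps3) (P : C * C * C) : R :=
  let '(P1, P2, P3) := P in
  2 * Re (ps_eval nu1 P * Cconj P1 + ps_eval nu2 P * Cconj P2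
          + ps_eval nu3 P * Cconj P3)%C.

(* Main.v *)
Require Import Defs.
From Stdlib Require Import Reals.
From Coquelicot Require Import Coquelicot.
From Stdlib Require Import Lra Lia FunctionalExtensionality Classical Wf_nat Ranalysis5.

(** Write [f = x1^2 + G(x2, x3)].  Dividing by [f], which is monic in [x1], leaves
    [r0 + x1 r1]; if this is nilpotent modulo [f], then so is its norm [r0^2 + G r1^2],
    which does not involve [x1] and hence vanishes.  The lexicographic leading exponent
    of [x3] is even in [r0^2] and odd in [G r1^2], so [r0 = r1 = 0]: [D] is reduced.

    Let [V] be logarithmic, [V(f) = h f].  With [v = x2 - 3 x3] and [w = x3], comparing
    coefficients shows that modulo [x1] the linear part of [V] is
    [h(0)/6 (2 v d/dv + w d/dw)].  Near [x1 = 0] the radial product is therefore close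
    to twice the real part of
    [h(0)/6 ((2 v + 3 w) conj (v + 3 w) + w conj w)], which for [v = t w] with [t] real
    is [h(0)/6 (2 t^2 + 9 t + 10) |w|^2].  This form is indefinite, so if
    [Re h(0) <> 0] the radial product changes sign along a path in [D] close to the
    origin.  If [Re h(0) = 0], its mean over a circle [|s| = rho] on the curve
    [(i s^3, 3 s, s)] in [D] is a multiple of [Re h(0)], hence zero. *)

Open Scope R_scope.

(** With 3 replaced by a real number a, the form on v = t w is 2 t^2 + 3 a t + a^2 + 1, of
    discriminant a^2 - 8. It takes negative values exactly when a^2 > 8, and 3 is the least positive
    integer with this property.

    The two cases need different tools. If Re h(0) = 0, the leading term on the real path vanishes
    and the sign would depend on higher-order terms that h(0) does not control. A mean value treats
    all orders at once: the curve is an orbit, on v = 0, of the weighted action with weights 3, 2,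
    1, so every monomial restricts to a multiple of a single power of s. Integrating against conj
    x_i keeps only finitely many coefficients, in combinations that the logarithmic equation
    determines. If Re h(0) <> 0, this mean is not zero, and the indefinite form is what gives a
    zero.

    For reducedness, the norm argument takes place among formal power series, whereas membership in
    the ideal asks for a convergent quotient; this is why the division is carried out explicitly,
    with Cauchy estimates. *)

(** * Rearranging finite sums in an abelian monoid *)

Lemma sum_n_triangle {G : AbelianMonoid} (g : nat -> nat -> G) (N : nat) :
  sum_n (fun n => sum_n (fun i => g i (n - i)%nat) n) N =
  sum_n (fun i => sum_n (g i) (N - i)) N.
Proof.
  induction N as [|N IH].
  - now rewrite !sum_O.
  - rewrite sum_Sn, IH, !sum_Sn, Nat.sub_diag, sum_O.
    rewrite plus_assoc, <- sum_n_plus. f_equal.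
    apply sum_n_ext_loc. intros i Hi.
    now rewrite (Nat.sub_succ_l i N), sum_Sn.
Qed.

Lemma sum_n_rev {G : AbelianMonoid} (f : nat -> G) (n : nat) :
  sum_n f n = sum_n (fun p => f (n - p)%nat) n.
Proof.
  revert f. induction n as [|n IH]; intro f.
  - now rewrite !sum_O.
  - rewrite sum_Sn, IH. unfold sum_n at 2.
    rewrite sum_Sn_m, plus_comm by lia. f_equal.
    rewrite <- sum_n_m_S. apply sum_n_m_ext_loc. intros k Hk. f_equal; lia.
Qed.

Lemma sum_n_zero {G : AbelianMonoid} (f : nat -> G) (n : nat) :
  (forall i, (i <= n)%nat -> f i = zero) -> sum_n f n = zero.
Proof.
  induction n as [|n IH]; intros H.
  - rewrite sum_O. now apply H.
  - rewrite sum_Sn, IH by (intros; apply H; lia).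
    rewrite plus_zero_l. apply H; lia.
Qed.

Lemma sum_n_single {G : AbelianMonoid} (f : nat -> G) (m n : nat) :
  (m <= n)%nat -> (forall i, (i <= n)%nat -> i <> m -> f i = zero) ->
  sum_n f n = f m.
Proof.
  induction n as [|n IH]; intros Hm H.
  - rewrite sum_O. f_equal; lia.
  - rewrite sum_Sn. destruct (Nat.eq_dec m (S n)) as [->|Hne].
    + rewrite sum_n_zero, plus_zero_l by (intros; apply H; lia). reflexivity.
    + rewrite IH by (try lia; intros; apply H; lia).
      rewrite (H (S n)) by lia. apply plus_zero_r.
Qed.

(** * Formal power series *)

(** Univariate series over an arbitrary ring: three iterations starting from [C_Ring] give the ring
    axioms for [ps3], without manipulating triple sums. *)
Definition fps (K : Ring) := nat -> K.

Definition fps_AbelianMonoid_mixin (K : Ring) : AbelianMonoid.mixin_of (fps K).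
Proof.
  apply (AbelianMonoid.Mixin (fps K) (fun a b n => plus (a n) (b n)) (fun _ => zero));
    intros; apply functional_extensionality; intro.
  - apply plus_comm.
  - apply plus_assoc.
  - apply plus_zero_r.
Defined.

Canonical fps_AbelianMonoid (K : Ring) :=
  AbelianMonoid.Pack (fps K) (fps_AbelianMonoid_mixin K) (fps K).

Definition fps_AbelianGroup_mixin (K : Ring) :
  AbelianGroup.mixin_of (fps_AbelianMonoid K).
Proof.
  apply (AbelianGroup.Mixin (fps_AbelianMonoid K) (fun a n => opp (a n))).
  intros a; apply functional_extensionality; intro n. exact (plus_opp_r (a n)).
Defined.

Canonical fps_AbelianGroup (K : Ring) :=
  AbelianGroup.Pack (fps K)
    (AbelianGroup.Class (fps K) (fps_AbelianMonoid_mixin K) (fps_AbelianGroup_mixin K))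
    (fps K).

Definition cauchy_product {K : Ring} (a b : fps K) : fps K :=
  fun n => sum_n (fun p => mult (a p) (b (n - p)%nat)) n.

Definition fps_one {K : Ring} : fps K :=
  fun n => match n with O => one | S _ => zero end.

Lemma cauchy_product_assoc {K : Ring} (a b c : fps K) :
  cauchy_product a (cauchy_product b c) = cauchy_product (cauchy_product a b) c.
Proof.
  apply functional_extensionality; intro N. unfold cauchy_product. symmetry.
  set (g := fun i m => mult (mult (a i) (b m)) (c (N - i - m)%nat)).
  transitivity (sum_n (fun n => sum_n (fun i => g i (n - i)%nat) n) N).
  { apply sum_n_ext_loc. intros n Hn. rewrite <- sum_n_mult_r.
    apply sum_n_ext_loc. intros i Hi. unfold g. do 2 f_equal. lia. }
  rewrite sum_n_triangle.
  apply sum_n_ext. intro i. rewrite <- sum_n_mult_l.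
  apply sum_n_ext. intro m. symmetry. apply mult_assoc.
Qed.

Lemma cauchy_product_one_r {K : Ring} (a : fps K) : cauchy_product a fps_one = a.
Proof.
  apply functional_extensionality; intro n. unfold cauchy_product.
  rewrite (sum_n_single _ n) by
    (try lia; intros i Hi Hne; replace (n - i)%nat with (S (n - i - 1)) by lia;
         apply mult_zero_r).
  rewrite Nat.sub_diag. apply mult_one_r.
Qed.

Lemma cauchy_product_one_l {K : Ring} (a : fps K) : cauchy_product fps_one a = a.
Proof.
  apply functional_extensionality; intro n. unfold cauchy_product.
  rewrite (sum_n_single _ 0) by
    (try lia; intros i Hi Hne; replace i with (S (i - 1)) by lia;
         apply mult_zero_l).
  rewrite Nat.sub_0_r. apply mult_one_l.
Qed.

Definition fps_Ring_mixin (K : Ring) : Ring.mixin_of (fps_AbelianGroup K).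
Proof.
  apply (Ring.Mixin (fps_AbelianGroup K) cauchy_product fps_one).
  - apply cauchy_product_assoc.
  - apply cauchy_product_one_r.
  - apply cauchy_product_one_l.
  - intros a b c; apply functional_extensionality; intro n.
    change (sum_n (fun p => mult (plus (a p) (b p)) (c (n - p)%nat)) n =
            plus (cauchy_product a c n) (cauchy_product b c n)).
    unfold cauchy_product. rewrite <- sum_n_plus.
    apply sum_n_ext. intro. apply mult_distr_r.
  - intros a b c; apply functional_extensionality; intro n.
    change (sum_n (fun p => mult (a p) (plus (b (n - p)%nat) (c (n - p)%nat))) n =
            plus (cauchy_product a b n) (cauchy_product a c n)).
    unfold cauchy_product. rewrite <- sum_n_plus.
    apply sum_n_ext. intro. apply mult_distr_l.
Defined.

Canonical fps_Ring (K : Ring) :=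
  Ring.Pack (fps K)
    (Ring.Class (fps K)
       (AbelianGroup.Class (fps K) (fps_AbelianMonoid_mixin K) (fps_AbelianGroup_mixin K))
       (fps_Ring_mixin K))
    (fps K).

(** A [Ring] need not be commutative, so commutativity of the coefficients is a hypothesis; it is
    lifted once per variable. *)
Lemma fps_mult_comm (K : Ring) :
  (forall x y : K, mult x y = mult y x) -> forall a b : fps K, mult a b = mult b a.
Proof.
  intros H a b. apply functional_extensionality; intro n.
  change (cauchy_product a b n = cauchy_product b a n).
  unfold cauchy_product. rewrite sum_n_rev. apply sum_n_ext_loc. intros p Hp.
  rewrite H. f_equal. f_equal. lia.
Qed.

Lemma sum_n_fps {K : Ring} (F : nat -> fps_Ring K) (N n : nat) :
  (sum_n F N : fps K) n = sum_n (fun i => F i n) N.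
Proof.
  induction N as [|N IH].
  - now rewrite !sum_O.
  - rewrite !sum_Sn, <- IH. reflexivity.
Qed.

Definition ps3_Ring : Ring := fps_Ring (fps_Ring (fps_Ring C_Ring)).

Lemma ps_ext (a b : ps3) : (forall i j k, a i j k = b i j k) -> a = b.
Proof.
  intro H. do 3 (apply functional_extensionality; intro). apply H.
Qed.

(** The bridge that transports the ring axioms, and the additivity of orders, to the triple sum of
    [ps_mul]. *)
Lemma ps_mul_fps (a b : ps3) : ps_mul a b = @mult ps3_Ring a b.
Proof.
  apply ps_ext; intros i j k.
  change (@mult ps3_Ring a b) with (cauchy_product (K := fps_Ring (fps_Ring C_Ring)) a b).
  unfold cauchy_product. rewrite 2!sum_n_fps. unfold ps_mul.
  apply sum_n_ext. intro p.
  change (@mult (fps_Ring (fps_Ring C_Ring)) (a p) (b (i - p)%nat))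
    with (cauchy_product (K := fps_Ring C_Ring) (a p) (b (i - p)%nat)).
  unfold cauchy_product. rewrite sum_n_fps.
  reflexivity.
Qed.

Lemma ps_add_fps (a b : ps3) : ps_add a b = @plus ps3_Ring a b.
Proof. reflexivity. Qed.

Lemma ps_one_fps : ps_one = @one ps3_Ring.
Proof. apply ps_ext; intros [|i] [|j] [|k]; reflexivity. Qed.

Definition ps_zero : ps3 := fun _ _ _ => RtoC 0.
Definition ps_opp (a : ps3) : ps3 := fun i j k => (- a i j k)%C.

Lemma ps_ring_theory : ring_theory ps_zero ps_one ps_add ps_mul ps_sub ps_opp eq.
Proof.
  split.
  - intro x. apply (@plus_zero_l ps3_Ring).
  - intros x y. apply (@plus_comm ps3_Ring).
  - intros x y z. apply (@plus_assoc ps3_Ring).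
  - intro x. rewrite ps_mul_fps, ps_one_fps. apply (@mult_one_l ps3_Ring).
  - intros x y. rewrite !ps_mul_fps.
    apply (fps_mult_comm (fps_Ring (fps_Ring C_Ring))).
    apply (fps_mult_comm (fps_Ring C_Ring)).
    apply (fps_mult_comm C_Ring). exact Cmult_comm.
  - intros x y z. rewrite !ps_mul_fps. apply (@mult_assoc ps3_Ring).
  - intros x y z. rewrite !ps_mul_fps, !ps_add_fps. apply (@mult_distr_r ps3_Ring).
  - reflexivity.
  - intro x. apply (@plus_opp_r ps3_Ring).
Qed.

Add Ring ps3_ring : ps_ring_theory.

(** Makes scalars elements of the ring, so that [ring] can treat [ps_scal] as a multiplication. *)
Definition ps_cst (c : C) : ps3 := ps_scal c ps_one.

Lemma ps_monomial_eq (p q s : nat) : ps_monomial p q s p q s = RtoC 1.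
Proof. unfold ps_monomial. now rewrite !Nat.eqb_refl. Qed.

Lemma ps_monomial_neq (p q s i j k : nat) :
  (i, j, k) <> (p, q, s) -> ps_monomial p q s i j k = RtoC 0.
Proof.
  intro H. unfold ps_monomial.
  destruct (Nat.eqb_spec i p), (Nat.eqb_spec j q), (Nat.eqb_spec k s); try reflexivity.
  subst. now elim H.
Qed.

(** The product with a monomial in a form that computes: it gives the coefficients of multiples of
    [fG] and of the partial derivatives of [fD] without sums. The tests guard against truncated
    subtraction. *)
Definition ps_shift (p q s : nat) (a : ps3) : ps3 := fun i j k =>
  if andb (Nat.leb p i) (andb (Nat.leb q j) (Nat.leb s k))
  then a (i - p)%nat (j - q)%nat (k - s)%nat else RtoC 0.

Lemma sum_n_C0 (f : nat -> C) (n : nat) :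
  (forall i, (i <= n)%nat -> f i = RtoC 0) -> sum_n f n = RtoC 0.
Proof. exact (sum_n_zero f n). Qed.

Lemma ps_mul_monomial (p q s : nat) (a : ps3) :
  ps_mul (ps_monomial p q s) a = ps_shift p q s a.
Proof.
  apply ps_ext; intros i j k. unfold ps_mul, ps_shift.
  destruct (Nat.leb_spec p i).
  2:{ cbn [andb]. apply sum_n_C0; intros; apply sum_n_C0; intros; apply sum_n_C0; intros.
      rewrite ps_monomial_neq by (intros [= ]; lia). apply Cmult_0_l. }
  rewrite (sum_n_single _ p) by (try lia; intros; apply sum_n_C0; intros;
    apply sum_n_C0; intros;
    rewrite ps_monomial_neq by (intros [= ]; lia); apply Cmult_0_l).
  destruct (Nat.leb_spec q j).
  2:{ cbn [andb]. apply sum_n_C0; intros; apply sum_n_C0; intros.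
      rewrite ps_monomial_neq by (intros [= ]; lia). apply Cmult_0_l. }
  rewrite (sum_n_single _ q) by (try lia; intros;
    apply sum_n_C0; intros;
    rewrite ps_monomial_neq by (intros [= ]; lia); apply Cmult_0_l).
  destruct (Nat.leb_spec s k).
  2:{ cbn [andb]. apply sum_n_C0; intros.
      rewrite ps_monomial_neq by (intros [= ]; lia). apply Cmult_0_l. }
  rewrite (sum_n_single _ s) by (try lia; intros;
    rewrite ps_monomial_neq by (intros [= ]; lia); apply Cmult_0_l).
  rewrite ps_monomial_eq. apply Cmult_1_l.
Qed.

Lemma ps_scal_cst (c : C) (a : ps3) : ps_scal c a = ps_mul (ps_cst c) a.
Proof.
  transitivity (ps_scal c (ps_mul ps_one a)).
  - f_equal. ring.
  - apply ps_ext; intros i j k. unfold ps_cst, ps_scal, ps_mul.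
    rewrite <- (sum_n_mult_l (K := C_Ring) c). apply sum_n_ext; intro p.
    rewrite <- (sum_n_mult_l (K := C_Ring) c). apply sum_n_ext; intro q.
    rewrite <- (sum_n_mult_l (K := C_Ring) c). apply sum_n_ext; intro s.
    apply Cmult_assoc.
Qed.

Lemma ps_cst_add (c d : C) : ps_cst (c + d)%C = ps_add (ps_cst c) (ps_cst d).
Proof. apply ps_ext; intros. unfold ps_cst, ps_add, ps_scal. ring. Qed.

Lemma ps_cst_mul (c d : C) : ps_cst (c * d)%C = ps_mul (ps_cst c) (ps_cst d).
Proof.
  rewrite <- ps_scal_cst. apply ps_ext; intros. unfold ps_cst, ps_scal. ring.
Qed.

Lemma ps_one_cst : ps_one = ps_cst (RtoC 1).
Proof. apply ps_ext; intros. unfold ps_cst, ps_scal. ring. Qed.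

Lemma ps_monomial_mul (p q s i j k : nat) :
  ps_mul (ps_monomial p q s) (ps_monomial i j k) = ps_monomial (p + i) (q + j) (s + k).
Proof.
  rewrite ps_mul_monomial. apply ps_ext; intros u v w. unfold ps_shift.
  destruct (Nat.leb_spec p u), (Nat.leb_spec q v), (Nat.leb_spec s w); cbn [andb];
  try (rewrite ps_monomial_neq; [reflexivity | intros [= ]; lia]).
  unfold ps_monomial.
  replace (u - p =? i)%nat with (u =? p + i)%nat
    by (destruct (Nat.eqb_spec u (p + i)), (Nat.eqb_spec (u - p) i); lia).
  replace (v - q =? j)%nat with (v =? q + j)%nat
    by (destruct (Nat.eqb_spec v (q + j)), (Nat.eqb_spec (v - q) j); lia).
  replace (w - s =? k)%nat with (w =? s + k)%nat
    by (destruct (Nat.eqb_spec w (s + k)), (Nat.eqb_spec (w - s) k); lia).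
  reflexivity.
Qed.

(** * Lexicographic leading exponents *)

Lemma cauchy_product_lead {K : Ring} (a b : fps K) (n m : nat) :
  (forall p, (p < n)%nat -> a p = zero) ->
  (forall p, (p < m)%nat -> b p = zero) ->
  (forall l, (l < n + m)%nat -> cauchy_product a b l = zero) /\
  cauchy_product a b (n + m)%nat = mult (a n) (b m).
Proof.
  intros Ha Hb. unfold cauchy_product. split.
  - intros l Hl. apply sum_n_zero. intros p Hp.
    destruct (Nat.lt_ge_cases p n).
    + rewrite Ha by assumption. apply mult_zero_l.
    + rewrite (Hb (l - p)%nat) by lia. apply mult_zero_r.
  - rewrite (sum_n_single _ n).
    + f_equal. f_equal. lia.
    + lia.
    + intros p Hp Hne. destruct (Nat.lt_ge_cases p n).
      * rewrite Ha by assumption. apply mult_zero_l.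
      * rewrite (Hb (n + m - p)%nat) by lia. apply mult_zero_r.
Qed.

Lemma fps_order_exists {K : Ring} (a : fps K) :
  a <> (fun _ => zero) ->
  exists n, (forall p, (p < n)%nat -> a p = zero) /\ a n <> zero.
Proof.
  intro Ha.
  destruct (dec_inh_nat_subset_has_unique_least_element (fun n => a n <> zero))
    as [n [[Hn Hmin] _]].
  - intro n. apply classic.
  - apply not_all_ex_not. intro H. apply Ha. now apply functional_extensionality.
  - exists n. split; [|assumption].
    intros p Hp. apply NNPP. intro H. apply Hmin in H. lia.
Qed.

(** [x1^i x2^j x3^k] is the lexicographically smallest monomial of [a]. *)
Definition lex_lead (a : ps3) (i j k : nat) : Prop :=
  (forall p, (p < i)%nat -> a p = fun _ _ => RtoC 0) /\
  (forall q, (q < j)%nat -> a i q = fun _ => RtoC 0) /\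
  (forall s, (s < k)%nat -> a i j s = RtoC 0) /\
  a i j k <> RtoC 0.

Lemma lex_lead_exists (a : ps3) :
  a <> ps_zero -> exists i j k, lex_lead a i j k.
Proof.
  intro Ha.
  destruct (fps_order_exists (K := fps_Ring (fps_Ring C_Ring)) a Ha) as [i [Hi Hai]].
  destruct (fps_order_exists (K := fps_Ring C_Ring) (a i) Hai) as [j [Hj Haj]].
  destruct (fps_order_exists (K := C_Ring) (a i j) Haj) as [k [Hk Hak]].
  now exists i, j, k.
Qed.

(** Orders add in one variable, and the leading coefficient of the product is the product of the
    leading coefficients; this is applied to x1, x2, x3 in turn. It yields both that [ps3] is an
    integral domain and the parity argument. *)
Lemma lex_lead_mul (a b : ps3) (i j k p q s : nat) :
  lex_lead a i j k -> lex_lead b p q s ->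
  lex_lead (ps_mul a b) (i + p) (j + q) (k + s).
Proof.
  intros [A1 [A2 [A3 A4]]] [B1 [B2 [B3 B4]]]. rewrite ps_mul_fps.
  destruct (cauchy_product_lead (K := fps_Ring (fps_Ring C_Ring)) a b i p A1 B1) as [L1 E1].
  destruct (cauchy_product_lead (K := fps_Ring C_Ring) (a i) (b p) j q A2 B2) as [L2 E2].
  destruct (cauchy_product_lead (K := C_Ring) (a i j) (b p q) k s A3 B3) as [L3 E3].
  change (@mult ps3_Ring a b) with (cauchy_product (K := fps_Ring (fps_Ring C_Ring)) a b).
  unfold lex_lead. rewrite E1.
  change (@mult (fps_Ring (fps_Ring C_Ring)) (a i) (b p))
    with (cauchy_product (K := fps_Ring C_Ring) (a i) (b p)).
  rewrite E2.
  change (@mult (fps_Ring C_Ring) (a i j) (b p q))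
    with (cauchy_product (K := C_Ring) (a i j) (b p q)).
  rewrite E3.
  repeat split; try assumption. now apply Cmult_neq_0.
Qed.

Lemma lex_lead_neq_zero (a : ps3) (i j k : nat) : lex_lead a i j k -> a <> ps_zero.
Proof. intros [_ [_ [_ H]]] ->. now apply H. Qed.

(** Only the exponent of x3 is compared, since its parity separates r0^2 from G r1^2. *)
Lemma lex_lead_unique_k (a : ps3) (i j k p q s : nat) :
  lex_lead a i j k -> lex_lead a p q s -> k = s.
Proof.
  intros [A1 [A2 [A3 A4]]] [B1 [B2 [B3 B4]]].
  assert (i = p) as <-.
  { destruct (Nat.lt_trichotomy i p) as [H|[H|H]]; [|exact H|].
    - elim A4. now rewrite (B1 i H).
    - elim B4. now rewrite (A1 p H). }
  assert (j = q) as <-.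
  { destruct (Nat.lt_trichotomy j q) as [H|[H|H]]; [|exact H|].
    - elim A4. now rewrite (B2 j H).
    - elim B4. now rewrite (A2 q H). }
  destruct (Nat.lt_trichotomy k s) as [H|[H|H]]; [|exact H|].
  - elim A4. now rewrite (B3 k H).
  - elim B4. now rewrite (A3 s H).
Qed.

Lemma ps_mul_eq_zero (a b : ps3) :
  ps_mul a b = ps_zero -> a = ps_zero \/ b = ps_zero.
Proof.
  intro H. apply NNPP. intro H'. apply not_or_and in H' as [Ha Hb].
  destruct (lex_lead_exists a Ha) as [i [j [k La]]].
  destruct (lex_lead_exists b Hb) as [p [q [s Lb]]].
  exact (lex_lead_neq_zero _ _ _ _ (lex_lead_mul _ _ _ _ _ _ _ _ La Lb) H).
Qed.

Lemma ps_pow_eq_zero (a : ps3) (n : nat) : ps_pow a n = ps_zero -> a = ps_zero.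
Proof.
  induction n as [|n IH]; simpl; intro H.
  - assert (E : ps_one 0%nat 0%nat 0%nat = RtoC 0) by now rewrite H.
    injection E as E. lra.
  - apply ps_mul_eq_zero in H as [H|H]; auto.
Qed.

Lemma ps_mul_scal_l (c : C) (a b : ps3) :
  ps_mul (ps_scal c a) b = ps_scal c (ps_mul a b).
Proof. rewrite (ps_scal_cst c a), (ps_scal_cst c (ps_mul a b)). ring. Qed.

Lemma ps_mul_add_l (a b c : ps3) :
  ps_mul (ps_add a b) c = ps_add (ps_mul a c) (ps_mul b c).
Proof. ring. Qed.

(** * The equation *)

Definition fD : ps3 := (X1 ^ 2 + (X2 - RtoC 3 *: X3) ^ 3 + X3 ^ 6)%ps.

(** [(x2 - 3 x3)^3 + x3^6], so that [fD = x1^2 + fG]. *)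
Definition fG : ps3 :=
  (ps_monomial 0 3 0 + (RtoC (-9) *: ps_monomial 0 2 1 + (RtoC 27 *: ps_monomial 0 1 2
   + (RtoC (-27) *: ps_monomial 0 0 3 + ps_monomial 0 0 6))))%ps.

Lemma ps_cubic_expansion (a b c : ps3) (t : C) :
  (a ^ 2 + (b - t *: c) ^ 3 + c ^ 6 =
   a ^ 2 + (b ^ 3 + ((- (RtoC 3 * t))%C *: (b ^ 2 * c) + ((RtoC 3 * (t * t))%C *: (b * c ^ 2)
    + ((- (t * (t * t)))%C *: c ^ 3 + c ^ 6)))))%ps.
Proof.
  replace (- (RtoC 3 * t))%C with (- RtoC 3 * t)%C by ring.
  replace (- (t * (t * t)))%C with (- RtoC 1 * (t * (t * t)))%C by ring.
  (* To [ring] each [ps_cst c] is an atom, so the scalars are first written through 1 and [t]. *)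
  replace (RtoC 3) with (RtoC 1 + (RtoC 1 + RtoC 1))%C
    by (rewrite <- !RtoC_plus; f_equal; lra).
  assert (O : forall c, ps_cst (- c) = ps_opp (ps_cst c)).
  { intro. apply ps_ext; intros. unfold ps_opp, ps_cst, ps_scal. ring. }
  rewrite !ps_scal_cst, !ps_cst_mul, !O, !ps_cst_add, <- !ps_one_cst.
  cbn [ps_pow]. ring.
Qed.

Lemma fD_eq : fD = (ps_monomial 2 0 0 + fG)%ps.
Proof.
  unfold fD. rewrite ps_cubic_expansion. unfold fG, X1, X2, X3.
  assert (O : forall p q s, ps_mul (ps_monomial p q s) ps_one = ps_monomial p q s)
    by (intros; ring).
  cbn [ps_pow]. rewrite !O, !ps_monomial_mul. cbn [Nat.add].
  rewrite <- !RtoC_mult, <- !RtoC_opp.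
  do 2 f_equal.
  replace (- (3 * 3)) with (-9) by lra. replace (3 * (3 * 3)) with 27 by lra.
  reflexivity.
Qed.

Lemma fG_mul (a : ps3) : ps_mul fG a =
  (ps_shift 0 3 0 a + (RtoC (-9) *: ps_shift 0 2 1 a + (RtoC 27 *: ps_shift 0 1 2 a
   + (RtoC (-27) *: ps_shift 0 0 3 a + ps_shift 0 0 6 a))))%ps.
Proof.
  unfold fG. now rewrite !ps_mul_add_l, !ps_mul_scal_l, !ps_mul_monomial.
Qed.

(** * Division by the equation *)

Definition indep_x1 (a : ps3) : Prop := forall i j k, a (S i) j k = RtoC 0.

Lemma indep_x1_mul (a b : ps3) : indep_x1 a -> indep_x1 b -> indep_x1 (ps_mul a b).
Proof.
  intros Ha Hb i j k. unfold ps_mul.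
  apply sum_n_C0; intros p Hp; apply sum_n_C0; intros q _; apply sum_n_C0; intros s _.
  destruct p as [|p].
  - rewrite Nat.sub_0_r, Hb. apply Cmult_0_r.
  - rewrite Ha. apply Cmult_0_l.
Qed.

Lemma indep_x1_add (a b : ps3) : indep_x1 a -> indep_x1 b -> indep_x1 (ps_add a b).
Proof. intros Ha Hb i j k. unfold ps_add. rewrite Ha, Hb. apply Cplus_0_l. Qed.

Lemma indep_x1_monomial (q s : nat) : indep_x1 (ps_monomial 0 q s).
Proof. intros i j k. apply ps_monomial_neq. congruence. Qed.

Lemma indep_x1_scal (c : C) (a : ps3) : indep_x1 a -> indep_x1 (ps_scal c a).
Proof. intros Ha i j k. unfold ps_scal. rewrite Ha. apply Cmult_0_r. Qed.

Lemma indep_x1_pow (a : ps3) (n : nat) : indep_x1 a -> indep_x1 (ps_pow a n).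
Proof.
  intro Ha. induction n as [|n IH]; simpl.
  - apply indep_x1_monomial.
  - now apply indep_x1_mul.
Qed.

Lemma indep_x1_fG : indep_x1 fG.
Proof.
  unfold fG. repeat apply indep_x1_add; try apply indep_x1_scal; apply indep_x1_monomial.
Qed.

(** The leading term is -27 x3^3; its odd exponent is what the parity argument needs. *)
Lemma lex_lead_fG : lex_lead fG 0 0 3.
Proof.
  repeat split.
  - intros p Hp. lia.
  - intros q Hq. lia.
  - intros s Hs. destruct s as [|[|[|s]]]; [| | |lia];
    unfold fG, ps_add, ps_scal, ps_monomial; cbn [Nat.eqb andb]; ring.
  - unfold fG, ps_add, ps_scal, ps_monomial; cbn [Nat.eqb andb].
    intro E. apply (f_equal fst) in E. simpl in E. lra.
Qed.

(** Every monomial of [fG] has positive degree in (x2, x3), so a product with [fG] only sees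
    coefficients of strictly smaller degree j + k. This drives the inductions on j + k below. *)
Lemma fG_mul_local (a b : ps3) (j k : nat) :
  (forall i j' k', (j' + k' < j + k)%nat -> a i j' k' = b i j' k') ->
  forall i, ps_mul fG a i j k = ps_mul fG b i j k.
Proof.
  intros H i. rewrite !fG_mul. unfold ps_add, ps_scal, ps_shift.
  destruct (Nat.leb_spec 0 i); [|lia]. cbn [andb].
  repeat match goal with |- context [Nat.leb ?x ?y] => destruct (Nat.leb_spec x y) end;
    cbn [andb]; rewrite ?(H (i - 0)%nat) by lia; reflexivity.
Qed.

(** A multiple [q f] that does not involve [x1] satisfies [q_i = - G q_(i+2)], where
    [f = x1^2 + G], so that the [q_i] lie in every power of the ideal [(x2, x3)]. *)
Lemma indep_x1_multiple (M q : ps3) :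
  indep_x1 M -> M = ps_mul q fD -> M = ps_zero.
Proof.
  intros HM E.
  assert (E' : M = ps_add (ps_shift 2 0 0 q) (ps_mul fG q)).
  { rewrite E, fD_eq, <- ps_mul_monomial. ring. }
  assert (Hq : forall n i j k, (j + k < n)%nat -> q i j k = RtoC 0).
  { induction n as [|n IH]; intros i j k Hn; [lia|].
    assert (H := HM (S i) j k). rewrite E' in H.
    unfold ps_add, ps_shift in H. cbn [Nat.leb andb] in H.
    rewrite !Nat.sub_0_r in H. replace (S (S i) - 2)%nat with i in H by lia.
    rewrite (fG_mul_local q ps_zero) in H.
    - replace (ps_mul fG ps_zero) with ps_zero in H by ring.
      unfold ps_zero in H. rewrite <- H. ring.
    - intros i' j' k' H'. apply IH. lia. }
  assert (q = ps_zero) as ->.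
  { apply ps_ext; intros i j k. apply (Hq (S (j + k))). lia. }
  rewrite E. ring.
Qed.

(** Powers respect congruence modulo c. With c = [fD] it serves twice: to pass from g to its
    remainder, and from the product of conjugates to the norm. *)
Lemma ps_pow_add_mul (a b c : ps3) (n : nat) :
  exists d, ps_pow (ps_add a (ps_mul b c)) n = ps_add (ps_pow a n) (ps_mul d c).
Proof.
  induction n as [|n [d IH]].
  - exists ps_zero. simpl. ring.
  - exists (ps_add (ps_mul a d) (ps_mul b (ps_add (ps_pow a n) (ps_mul d c)))).
    simpl. rewrite IH. ring.
Qed.

Lemma ps_pow_mul (a b : ps3) (n : nat) :
  ps_pow (ps_mul a b) n = ps_mul (ps_pow a n) (ps_pow b n).
Proof. induction n as [|n IH]; simpl; [|rewrite IH]; ring. Qed.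

Lemma ps_sum_squares_base (r0 r1 : ps3) :
  ps_add (ps_mul r0 r0) (ps_mul fG (ps_mul r1 r1)) = ps_zero ->
  r0 = ps_zero /\ r1 = ps_zero.
Proof.
  intro E.
  assert (H1 : r1 = ps_zero).
  { apply NNPP. intro H1.
    assert (H0 : r0 <> ps_zero).
    { intros ->. assert (E' : ps_mul fG (ps_mul r1 r1) = ps_zero) by (rewrite <- E; ring).
      apply ps_mul_eq_zero in E' as [E'|E'].
      - exact (lex_lead_neq_zero _ _ _ _ lex_lead_fG E').
      - apply ps_mul_eq_zero in E'. tauto. }
    destruct (lex_lead_exists r0 H0) as [i [j [k L0]]].
    destruct (lex_lead_exists r1 H1) as [p [q [s L1]]].
    assert (La := lex_lead_mul _ _ _ _ _ _ _ _ L0 L0).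
    assert (Lb := lex_lead_mul _ _ _ _ _ _ _ _ lex_lead_fG
                    (lex_lead_mul _ _ _ _ _ _ _ _ L1 L1)).
    assert (Lc : lex_lead (ps_mul fG (ps_mul r1 r1)) (i + i) (j + j) (k + k)).
    { replace (ps_mul fG (ps_mul r1 r1)) with (ps_opp (ps_mul r0 r0)).
      - destruct La as [A1 [A2 [A3 A4]]]. unfold lex_lead, ps_opp. repeat split.
        + intros u Hu. rewrite (A1 u Hu). do 2 (apply functional_extensionality; intro). ring.
        + intros u Hu. rewrite (A2 u Hu). apply functional_extensionality; intro. ring.
        + intros u Hu. rewrite (A3 u Hu). ring.
        + intro A. apply A4. rewrite <- (Copp_0), <- A. ring.
      - transitivity (ps_sub (ps_add (ps_mul r0 r0) (ps_mul fG (ps_mul r1 r1)))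
                             (ps_mul r0 r0)); [rewrite E|]; ring. }
    (* The exponents of x3 would satisfy 3 + 2 s = 2 k. *)
    assert (H := lex_lead_unique_k _ _ _ _ _ _ _ Lb Lc). lia. }
  subst r1. split; [|reflexivity].
  assert (E' : ps_mul r0 r0 = ps_zero) by (rewrite <- E; ring).
  apply ps_mul_eq_zero in E'. tauto.
Qed.

(** With [N = r0^2 + G r1^2] the norm of [r = r0 + x1 r1], a power of [r] divisible
    by [f = x1^2 + G] gives a power of [N] divisible by [f]; as [N] does not involve
    [x1], it vanishes. *)
Lemma nilpotent_remainder (r0 r1 q p g : ps3) (n : nat) :
  indep_x1 r0 -> indep_x1 r1 ->
  g = ps_add (ps_mul q fD) (ps_add r0 (ps_mul X1 r1)) ->
  ps_pow g n = ps_mul p fD ->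
  g = ps_mul q fD.
Proof.
  intros I0 I1 Hg Hp.
  set (r := ps_add r0 (ps_mul X1 r1)) in *.
  set (r' := ps_sub r0 (ps_mul X1 r1)).
  set (N := ps_add (ps_mul r0 r0) (ps_mul fG (ps_mul r1 r1))).
  destruct (ps_pow_add_mul g (ps_opp q) fD n) as [d1 D1].
  replace (ps_add g (ps_mul (ps_opp q) fD)) with r in D1 by (rewrite Hg; ring).
  (* N = r r' + r1^2 f, because r r' = r0^2 - x1^2 r1^2 and f = x1^2 + G. *)
  destruct (ps_pow_add_mul (ps_mul r r') (ps_mul r1 r1) fD n) as [d2 D2].
  replace (ps_add (ps_mul r r') (ps_mul (ps_mul r1 r1) fD)) with N in D2.
  2:{ unfold N, r, r'. rewrite fD_eq.
      replace (ps_monomial 2 0 0) with (ps_mul X1 X1) by apply (ps_monomial_mul 1 0 0 1 0 0).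
      ring. }
  assert (HN : ps_pow N n =
    ps_mul (ps_add (ps_mul (ps_add p d1) (ps_pow r' n)) d2) fD).
  { rewrite D2, ps_pow_mul, D1, Hp. ring. }
  assert (IN : indep_x1 N).
  { apply indep_x1_add; repeat apply indep_x1_mul; auto using indep_x1_fG. }
  assert (N0 := ps_pow_eq_zero _ _ (indep_x1_multiple _ _ (indep_x1_pow _ n IN) HN)).
  apply ps_sum_squares_base in N0 as [-> ->].
  rewrite Hg. unfold r. ring.
Qed.

(** * Convergence and evaluation *)

(** Cauchy estimates. Unlike the summability in [convergent], they pass through shifts, sums and
    coefficientwise limits with explicit constants; returning to summability costs a smaller
    radius. *)
Definition coef_bound (a : ps3) (r B : R) : Prop :=
  forall i j k, Cmod (a i j k) * r ^ (i + j + k) <= B.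

Lemma coef_bound_nonneg (a : ps3) (r B : R) : 0 <= r -> coef_bound a r B -> 0 <= B.
Proof.
  intros Hr H. eapply Rle_trans; [|apply (H 0 0 0)%nat].
  apply Rmult_le_pos; [apply Cmod_ge_0 | now apply pow_le].
Qed.

Lemma coef_bound_le (a : ps3) (r r' B : R) :
  0 <= r' <= r -> coef_bound a r B -> coef_bound a r' B.
Proof.
  intros Hr H i j k. eapply Rle_trans; [|apply (H i j k)].
  apply Rmult_le_compat_l; [apply Cmod_ge_0 | now apply pow_incr].
Qed.

Lemma coef_bound_weaken (a : ps3) (r B B' : R) :
  B <= B' -> coef_bound a r B -> coef_bound a r B'.
Proof. intros HB H i j k. eapply Rle_trans; [apply H | exact HB]. Qed.

Lemma coef_bound_add (a b : ps3) (r A B : R) :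
  0 <= r -> coef_bound a r A -> coef_bound b r B -> coef_bound (ps_add a b) r (A + B).
Proof.
  intros Hr Ha Hb i j k. unfold ps_add.
  eapply Rle_trans; [|apply Rplus_le_compat; [apply Ha|apply Hb]].
  rewrite <- Rmult_plus_distr_r.
  apply Rmult_le_compat_r; [now apply pow_le | apply Cmod_triangle].
Qed.

Lemma coef_bound_scal (c : C) (a : ps3) (r A : R) :
  coef_bound a r A -> coef_bound (ps_scal c a) r (Cmod c * A).
Proof.
  intros Ha i j k. unfold ps_scal. rewrite Cmod_mult, Rmult_assoc.
  apply Rmult_le_compat_l; [apply Cmod_ge_0 | apply Ha].
Qed.

Lemma ps_sub_scal (a b : ps3) : ps_sub a b = ps_add a (ps_scal (RtoC (-1)) b).
Proof. apply ps_ext; intros. unfold ps_sub, ps_add, ps_scal. 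
  replace (RtoC (-1)) with (- RtoC 1)%C by (rewrite <- RtoC_opp; f_equal; lra). ring.
Qed.

Lemma coef_bound_sub (a b : ps3) (r A B : R) :
  0 <= r -> coef_bound a r A -> coef_bound b r B -> coef_bound (ps_sub a b) r (A + B).
Proof.
  intros Hr Ha Hb. rewrite ps_sub_scal. apply coef_bound_add; try assumption.
  apply coef_bound_weaken with (Cmod (RtoC (-1)) * B); [|now apply coef_bound_scal].
  rewrite Cmod_R, Rabs_left by lra. lra.
Qed.

Lemma coef_bound_shift (p q s : nat) (a : ps3) (r A : R) :
  0 <= r -> coef_bound a r A -> coef_bound (ps_shift p q s a) r (r ^ (p + q + s) * A).
Proof.
  intros Hr Ha i j k. unfold ps_shift.
  destruct (Nat.leb_spec p i), (Nat.leb_spec q j), (Nat.leb_spec s k); cbn [andb];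
    try (rewrite Cmod_0, Rmult_0_l; apply Rmult_le_pos;
         [now apply pow_le | now apply (coef_bound_nonneg a r)]).
  replace (i + j + k)%nat with (p + q + s + (i - p + (j - q) + (k - s)))%nat by lia.
  rewrite pow_add.
  replace (Cmod _ * _) with
    (r ^ (p + q + s) * (Cmod (a (i - p) (j - q) (k - s))%nat * r ^ (i - p + (j - q) + (k - s))))
    by ring.
  apply Rmult_le_compat_l; [now apply pow_le | apply Ha].
Qed.

Lemma coef_bound_one (r : R) : coef_bound ps_one r 1.
Proof.
  intros i j k. unfold ps_one.
  destruct i as [|i]; [destruct j as [|j]; [destruct k as [|k]|]|];
    try (rewrite ps_monomial_neq, Cmod_0 by congruence; lra).
  rewrite ps_monomial_eq, Cmod_1. simpl. lra.
Qed.

Lemma coef_bound_monomial (p q s : nat) (r : R) :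
  0 <= r -> coef_bound (ps_monomial p q s) r (r ^ (p + q + s)).
Proof.
  intro Hr. replace (ps_monomial p q s) with (ps_shift p q s ps_one).
  - rewrite <- (Rmult_1_r (r ^ _)). apply coef_bound_shift; [exact Hr | apply coef_bound_one].
  - rewrite <- ps_mul_monomial. ring.
Qed.

Lemma Cmod_sum_n (f : nat -> C) (n : nat) :
  Cmod (sum_n f n) <= sum_n (fun i => Cmod (f i)) n.
Proof.
  induction n as [|n IH].
  - rewrite !sum_O. apply Rle_refl.
  - rewrite !sum_Sn. eapply Rle_trans; [apply Cmod_triangle|].
    apply Rplus_le_compat_r, IH.
Qed.

Lemma sum_n_le_loc (f g : nat -> R) (n : nat) :
  (forall i, (i <= n)%nat -> f i <= g i) -> sum_n f n <= sum_n g n.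
Proof.
  induction n as [|n IH]; intro H.
  - rewrite !sum_O. now apply H.
  - rewrite !sum_Sn. apply Rplus_le_compat; [apply IH; intros; apply H|apply H]; lia.
Qed.

Lemma sum_n_nonneg (f : nat -> R) (n : nat) :
  (forall i, (i <= n)%nat -> 0 <= f i) -> 0 <= sum_n f n.
Proof.
  intro H. rewrite <- (Rmult_0_r (INR (S n))), <- sum_n_const.
  now apply sum_n_le_loc.
Qed.

Lemma sum_n_term_le (f : nat -> R) (n m : nat) :
  (forall i, (i <= n)%nat -> 0 <= f i) -> (m <= n)%nat -> f m <= sum_n f n.
Proof.
  induction n as [|n IH]; intros H Hm.
  - rewrite sum_O. replace m with 0%nat by lia. apply Rle_refl.
  - rewrite sum_Sn. change (f m <= sum_n f n + f (S n)).
    destruct (Nat.eq_dec m (S n)) as [->|Hne].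
    + assert (0 <= sum_n f n) by (apply sum_n_nonneg; auto). lra.
    + assert (0 <= f (S n)) by (apply H; lia).
      assert (f m <= sum_n f n) by (apply IH; [auto | lia]). lra.
Qed.

Lemma sum_deg_term_le (t : nat -> nat -> nat -> R) (i j k : nat) :
  (forall i j k, 0 <= t i j k) -> t i j k <= sum_deg t (i + j + k).
Proof.
  intro H. unfold sum_deg. set (n := (i + j + k)%nat).
  eapply Rle_trans; [|apply (sum_n_term_le _ n i)]; [|intros; now apply sum_n_nonneg | lia].
  cbv beta. replace k with (n - i - j)%nat at 1 by lia.
  apply (sum_n_term_le (fun j => t i j (n - i - j)%nat)); [auto | lia].
Qed.

Lemma sum_deg_le (t : nat -> nat -> nat -> R) (n : nat) (M : R) :
  0 <= M -> (forall i j k, (i + j + k = n)%nat -> t i j k <= M) ->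
  sum_deg t n <= INR (S n) ^ 2 * M.
Proof.
  intros HM H. unfold sum_deg.
  replace (INR (S n) ^ 2 * M) with (INR (S n) * (INR (S n) * M)) by ring.
  rewrite <- sum_n_const. apply sum_n_le_loc. intros i Hi.
  apply Rle_trans with (INR (S (n - i)) * M).
  - rewrite <- sum_n_const. apply sum_n_le_loc. intros j Hj. apply H. lia.
  - apply Rmult_le_compat_r; [exact HM|]. apply le_INR. lia.
Qed.

Lemma Cmod_sum_deg (t : nat -> nat -> nat -> C) (n : nat) :
  Cmod (sum_deg t n) <= sum_deg (fun i j k => Cmod (t i j k)) n.
Proof.
  unfold sum_deg. eapply Rle_trans; [apply Cmod_sum_n|].
  apply sum_n_le_loc. intros i _. apply Cmod_sum_n.
Qed.

(** Absorbs the number of monomials of degree n, at most (n+1)^2, into a geometric factor. Hence the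
    ratio 2 m / r, rather than m / r, in the estimates below. *)
Lemma sqr_succ_le_pow2 (n : nat) : INR (S n) ^ 2 <= 4 * 2 ^ n.
Proof.
  destruct n as [|[|n]]; [simpl; lra | simpl; lra |].
  induction n as [|n IH]; [simpl; lra|].
  rewrite (S_INR (S (S (S n)))). change (2 ^ S (S (S n))) with (2 * 2 ^ S (S n)).
  assert (3 <= INR (S (S (S n)))).
  { rewrite !S_INR. assert (H := pos_INR n). lra. }
  nra.
Qed.

Lemma convergent_coef_bound (a : ps3) :
  convergent a -> exists r B, 0 < r /\ coef_bound a r B.
Proof.
  intros [r [Hr H]]. set (t := fun i j k => Cmod (a i j k) * r ^ (i + j + k)) in H.
  assert (Ht : forall i j k, 0 <= t i j k).
  { intros. apply Rmult_le_pos; [apply Cmod_ge_0 | apply pow_le; lra]. }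
  exists r, (Series (sum_deg t)). split; [exact Hr|]. intros i j k.
  apply Rle_trans with (sum_deg t (i + j + k)); [exact (sum_deg_term_le t i j k Ht)|].
  apply Rle_trans with (sum_n (sum_deg t) (i + j + k)).
  - apply sum_n_term_le; [|lia]. intros. unfold sum_deg.
    apply sum_n_nonneg; intros; now apply sum_n_nonneg.
  - apply (is_lim_seq_incr_compare (sum_n (sum_deg t))).
    + apply Series_correct in H. exact H.
    + intro n. rewrite sum_Sn. change (sum_n (sum_deg t) n <= sum_n (sum_deg t) n + sum_deg t (S n)).
      assert (0 <= sum_deg t (S n)); [|lra]. unfold sum_deg.
      apply sum_n_nonneg; intros; now apply sum_n_nonneg.
Qed.

Lemma sum_deg_bound_geom (a : ps3) (r B m : R) (n : nat) :
  0 < r -> 0 <= m -> coef_bound a r B ->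
  sum_deg (fun i j k => Cmod (a i j k) * m ^ (i + j + k)) n <= 4 * B * (2 * m / r) ^ n.
Proof.
  intros Hr Hm H. assert (HB := coef_bound_nonneg a r B (Rlt_le _ _ Hr) H).
  assert (Hq : 0 <= m / r) by (apply Rdiv_le_0_compat; lra).
  apply Rle_trans with (INR (S n) ^ 2 * (B * (m / r) ^ n)).
  - apply sum_deg_le.
    + apply Rmult_le_pos; [exact HB | now apply pow_le].
    + intros i j k <-. replace m with (r * (m / r)) at 1 by (field; lra).
      rewrite Rpow_mult_distr, <- Rmult_assoc.
      apply Rmult_le_compat_r; [now apply pow_le | apply H].
  - replace (4 * B * (2 * m / r) ^ n) with (4 * 2 ^ n * (B * (m / r) ^ n)).
    + apply Rmult_le_compat_r; [apply Rmult_le_pos; [exact HB | now apply pow_le]|].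
      apply sqr_succ_le_pow2.
    + replace (2 * m / r) with (2 * (m / r)) by (field; lra).
      rewrite Rpow_mult_distr. ring.
Qed.

Lemma coef_bound_convergent (a : ps3) (r B : R) :
  0 < r -> coef_bound a r B -> convergent a.
Proof.
  (* At radius m = r/4 the ratio 2 m / r is 1/2. *)
  intros Hr H. exists (r / 4). split; [lra|].
  apply (@ex_series_le R_AbsRing R_CompleteNormedModule) with (fun n => 4 * B * (1 / 2) ^ n).
  - intro n. change (Rabs (sum_deg (fun i j k => Cmod (a i j k) * (r / 4) ^ (i + j + k)) n)
                     <= 4 * B * (1 / 2) ^ n).
    rewrite Rabs_pos_eq.
    + replace (1 / 2) with (2 * (r / 4) / r) by (field; lra).
      apply sum_deg_bound_geom; lra || assumption.
    + unfold sum_deg. apply sum_n_nonneg; intros; apply sum_n_nonneg; intros.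
      apply Rmult_le_pos; [apply Cmod_ge_0 | apply pow_le; lra].
  - apply (ex_series_scal (V := R_NormedModule) (4 * B)). apply ex_series_geom.
    rewrite Rabs_pos_eq; lra.
Qed.

Definition eval_term (a : ps3) (P1 P2 P3 : C) (n : nat) : C :=
  sum_deg (fun i j k => (a i j k * (P1 ^ i * P2 ^ j * P3 ^ k))%C) n.

Lemma eval_term_bound (a : ps3) (P1 P2 P3 : C) (r B m : R) (n : nat) :
  0 < r -> coef_bound a r B -> Cmod P1 <= m -> Cmod P2 <= m -> Cmod P3 <= m ->
  Cmod (eval_term a P1 P2 P3 n) <= 4 * B * (2 * m / r) ^ n.
Proof.
  intros Hr H H1 H2 H3. assert (Hm : 0 <= m) by (eapply Rle_trans; [apply Cmod_ge_0 | exact H1]).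
  eapply Rle_trans; [|apply (sum_deg_bound_geom a r B m n Hr Hm H)].
  eapply Rle_trans; [apply Cmod_sum_deg|].
  unfold sum_deg. apply sum_n_le_loc; intros; apply sum_n_le_loc; intros.
  rewrite !Cmod_mult, !Cmod_pow, !pow_add. apply Rmult_le_compat_l; [apply Cmod_ge_0|].
  assert (P : forall x n, Cmod x <= m -> 0 <= Cmod x ^ n <= m ^ n).
  { intros x p Hx. split; [apply pow_le, Cmod_ge_0|].
    apply pow_incr; split; [apply Cmod_ge_0 | exact Hx]. }
  apply Rmult_le_compat; [apply Rmult_le_pos; now apply P | now apply P | | now apply P].
  apply Rmult_le_compat; now apply P.
Qed.

(** A relation that carries convergence along with the value: [Series] is total, so identities
    between values of [ps_eval] need convergence to be justified. *)
Definition has_eval (a : ps3) (P1 P2 P3 z : C) : Prop :=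
  is_series (fun n => Re (eval_term a P1 P2 P3 n)) (Re z) /\
  is_series (fun n => Im (eval_term a P1 P2 P3 n)) (Im z).

Lemma has_eval_eq (a : ps3) (P1 P2 P3 z : C) :
  has_eval a P1 P2 P3 z -> ps_eval a (P1, P2, P3) = z.
Proof.
  intros [H1 H2]. destruct z as [x y]. cbn in H1, H2.
  change ((Series (fun n => Re (eval_term a P1 P2 P3 n)),
           Series (fun n => Im (eval_term a P1 P2 P3 n))) = (x, y)).
  f_equal; now apply is_series_unique.
Qed.

Lemma sum_deg_plus {G : AbelianMonoid} (t u : nat -> nat -> nat -> G) (n : nat) :
  sum_deg (fun i j k => plus (t i j k) (u i j k)) n = plus (sum_deg t n) (sum_deg u n).
Proof.
  unfold sum_deg. rewrite <- sum_n_plus. apply sum_n_ext; intro.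
  apply sum_n_plus.
Qed.

Lemma eval_term_add (a b : ps3) (P1 P2 P3 : C) (n : nat) :
  eval_term (ps_add a b) P1 P2 P3 n = (eval_term a P1 P2 P3 n + eval_term b P1 P2 P3 n)%C.
Proof.
  unfold eval_term. rewrite <- (sum_deg_plus (G := C_AbelianMonoid)).
  unfold sum_deg. apply sum_n_ext; intro. apply sum_n_ext; intro.
  apply Cmult_plus_distr_r.
Qed.

Lemma eval_term_scal (c : C) (a : ps3) (P1 P2 P3 : C) (n : nat) :
  eval_term (ps_scal c a) P1 P2 P3 n = (c * eval_term a P1 P2 P3 n)%C.
Proof.
  unfold eval_term, sum_deg.
  rewrite <- (sum_n_mult_l (K := C_Ring) c). apply sum_n_ext; intro.
  rewrite <- (sum_n_mult_l (K := C_Ring) c). apply sum_n_ext; intro.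
  symmetry. apply Cmult_assoc.
Qed.

Lemma has_eval_add (a b : ps3) (P1 P2 P3 y z : C) :
  has_eval a P1 P2 P3 y -> has_eval b P1 P2 P3 z ->
  has_eval (ps_add a b) P1 P2 P3 (y + z)%C.
Proof.
  intros [A1 A2] [B1 B2]. split.
  - eapply is_series_ext; [|exact (is_series_plus _ _ _ _ A1 B1)].
    intro n. now rewrite eval_term_add.
  - eapply is_series_ext; [|exact (is_series_plus _ _ _ _ A2 B2)].
    intro n. now rewrite eval_term_add.
Qed.

Lemma has_eval_scal (c : C) (a : ps3) (P1 P2 P3 z : C) :
  has_eval a P1 P2 P3 z -> has_eval (ps_scal c a) P1 P2 P3 (c * z)%C.
Proof.
  intros [A1 A2]. split.
  - replace (Re (c * z)%C) with (plus (scal (Re c) (Re z)) (scal (- Im c) (Im z)))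
      by (unfold plus, scal; simpl; unfold mult; simpl; unfold Re, Im; ring).
    eapply is_series_ext;
      [|exact (is_series_plus _ _ _ _ (is_series_scal (Re c) _ _ A1)
                                      (is_series_scal (- Im c) _ _ A2))].
    intro n. rewrite eval_term_scal. unfold plus, scal; simpl. unfold mult, Re, Im; simpl. ring.
  - replace (Im (c * z)%C) with (plus (scal (Re c) (Im z)) (scal (Im c) (Re z)))
      by (unfold plus, scal; simpl; unfold mult; simpl; unfold Re, Im; ring).
    eapply is_series_ext;
      [|exact (is_series_plus _ _ _ _ (is_series_scal (Re c) _ _ A2)
                                      (is_series_scal (Im c) _ _ A1))].
    intro n. rewrite eval_term_scal. unfold plus, scal; simpl. unfold mult, Re, Im; simpl. ring.
Qed.

Lemma is_series_single (c : nat -> R) (m : nat) :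
  (forall n, n <> m -> c n = 0) -> is_series c (c m).
Proof.
  intro H. apply (filterlim_ext_loc (fun _ => c m)).
  - exists m. intros n Hn. symmetry. apply sum_n_single; auto.
  - apply filterlim_const.
Qed.

Lemma has_eval_monomial (p q s : nat) (P1 P2 P3 : C) :
  has_eval (ps_monomial p q s) P1 P2 P3 (P1 ^ p * P2 ^ q * P3 ^ s)%C.
Proof.
  assert (H0 : forall n, n <> (p + q + s)%nat ->
            eval_term (ps_monomial p q s) P1 P2 P3 n = RtoC 0).
  { intros n Hn. apply sum_n_C0; intros i Hi; apply sum_n_C0; intros j Hj.
    rewrite ps_monomial_neq by (intros [= ]; lia). apply Cmult_0_l. }
  assert (H1 : eval_term (ps_monomial p q s) P1 P2 P3 (p + q + s) =
               (P1 ^ p * P2 ^ q * P3 ^ s)%C).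
  { unfold eval_term, sum_deg. rewrite (sum_n_single _ p).
    - rewrite (sum_n_single _ q).
      + replace (p + q + s - p - q)%nat with s by lia.
        rewrite ps_monomial_eq. apply Cmult_1_l.
      + lia.
      + intros j Hj Hne. rewrite ps_monomial_neq by congruence. apply Cmult_0_l.
    - lia.
    - intros i Hi Hne. apply sum_n_C0; intros j Hj.
      rewrite ps_monomial_neq by congruence. apply Cmult_0_l. }
  rewrite <- H1. split.
  - apply (is_series_single (fun n => Re (eval_term (ps_monomial p q s) P1 P2 P3 n))).
    intros n Hn. now rewrite H0.
  - apply (is_series_single (fun n => Im (eval_term (ps_monomial p q s) P1 P2 P3 n))).
    intros n Hn. now rewrite H0.
Qed.

Lemma series_geom_tail (c : nat -> R) (K q : R) (N : nat) :
  0 <= q <= 1 / 2 -> (forall n, Rabs (c n) <= K * q ^ n) ->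
  ex_series c /\ Rabs (Series c - sum_n c N) <= 2 * K * q ^ S N.
Proof.
  intros Hq H.
  assert (HK : 0 <= K).
  { specialize (H 0%nat). simpl in H. assert (0 <= Rabs (c 0%nat)) by apply Rabs_pos. lra. }
  assert (Hgeom : Rabs q < 1) by (rewrite Rabs_pos_eq; lra).
  assert (Ec : ex_series c).
  { apply (@ex_series_le R_AbsRing R_CompleteNormedModule) with (fun n => K * q ^ n).
    - exact H.
    - apply (ex_series_scal (V := R_NormedModule) K). now apply ex_series_geom. }
  split; [exact Ec|].
  assert (Eg : ex_series (fun k => K * q ^ S N * q ^ k)).
  { apply (ex_series_scal (V := R_NormedModule) (K * q ^ S N)). now apply ex_series_geom. }
  rewrite (Series_incr_n c (S N)) by (lia || assumption).
  rewrite sum_n_Reals. cbn [Nat.pred]. unfold Rminus.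
  rewrite Rplus_comm, <- Rplus_assoc, Rplus_opp_l, Rplus_0_l.
  assert (Hb : forall k, 0 <= Rabs (c (S N + k)%nat) <= K * q ^ S N * q ^ k).
  { intro k. split; [apply Rabs_pos|].
    rewrite Rmult_assoc, <- pow_add. apply H. }
  eapply Rle_trans; [apply Series_Rabs|].
  - apply (@ex_series_le R_AbsRing R_CompleteNormedModule) with (fun k => K * q ^ S N * q ^ k).
    + intro k. change (Rabs (Rabs (c (S N + k)%nat)) <= K * q ^ S N * q ^ k).
      rewrite Rabs_Rabsolu. apply Hb.
    + exact Eg.
  - eapply Rle_trans; [apply (Series_le _ _ Hb Eg)|].
    rewrite Series_scal_l, Series_geom by assumption.
    assert (/ (1 - q) <= 2).
    { replace 2 with (/ (1 / 2)) by field. apply Rinv_le_contravar; lra. }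
    assert (0 <= K * q ^ S N) by (apply Rmult_le_pos; [exact HK | apply pow_le; lra]).
    nra.
Qed.

Lemma Re_sum_n (f : nat -> C) (n : nat) : Re (sum_n f n) = sum_n (fun i => Re (f i)) n.
Proof.
  induction n as [|n IH]; [now rewrite !sum_O|].
  rewrite !sum_Sn, <- IH. reflexivity.
Qed.

Lemma Im_sum_n (f : nat -> C) (n : nat) : Im (sum_n f n) = sum_n (fun i => Im (f i)) n.
Proof.
  induction n as [|n IH]; [now rewrite !sum_O|].
  rewrite !sum_Sn, <- IH. reflexivity.
Qed.

Lemma im_le_Cmod (c : C) : Rabs (Im c) <= Cmod c.
Proof. eapply Rle_trans; [apply Rmax_r | apply Rmax_Cmod]. Qed.

Lemma Cmod_le_Re_Im (c : C) : Cmod c <= Rabs (Re c) + Rabs (Im c).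
Proof.
  unfold Cmod. rewrite <- (sqrt_Rsqr (Rabs (Re c) + Rabs (Im c))).
  - apply sqrt_le_1_alt. unfold Rsqr, Re, Im.
    assert (H1 := Rabs_pos (fst c)). assert (H2 := Rabs_pos (snd c)).
    assert (E1 := pow2_abs (fst c)). assert (E2 := pow2_abs (snd c)). nra.
  - assert (H1 := Rabs_pos (Re c)). assert (H2 := Rabs_pos (Im c)). lra.
Qed.

(** The condition m <= r/4 keeps the ratio 2 m / r at most 1/2. The constant 16 is the 4 of
    [eval_term_bound], doubled by the geometric tail and again by adding real and imaginary
    parts. *)
Lemma eval_approx (a : ps3) (P1 P2 P3 : C) (r B m : R) :
  0 < r -> coef_bound a r B -> m <= r / 4 ->
  Cmod P1 <= m -> Cmod P2 <= m -> Cmod P3 <= m ->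
  has_eval a P1 P2 P3 (ps_eval a (P1, P2, P3)) /\
  forall N, Cmod (ps_eval a (P1, P2, P3) - sum_n (eval_term a P1 P2 P3) N)
            <= 16 * B * (2 * m / r) ^ S N.
Proof.
  intros Hr H Hm H1 H2 H3.
  assert (Hm0 : 0 <= m) by (eapply Rle_trans; [apply Cmod_ge_0 | exact H1]).
  assert (Hq : 0 <= 2 * m / r <= 1 / 2).
  { split; [apply Rdiv_le_0_compat; lra|].
    apply Rmult_le_reg_r with r; [exact Hr|]. field_simplify; lra. }
  assert (Hb := fun n => eval_term_bound a P1 P2 P3 r B m n Hr H H1 H2 H3).
  assert (TR := fun N => series_geom_tail (fun n => Re (eval_term a P1 P2 P3 n)) (4 * B)
    (2 * m / r) N Hq (fun n => Rle_trans _ _ _ (re_le_Cmod _) (Hb n))).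
  assert (TI := fun N => series_geom_tail (fun n => Im (eval_term a P1 P2 P3 n)) (4 * B)
    (2 * m / r) N Hq (fun n => Rle_trans _ _ _ (im_le_Cmod _) (Hb n))).
  split.
  - split; apply Series_correct; [apply (TR 0%nat) | apply (TI 0%nat)].
  - intro N. eapply Rle_trans; [apply Cmod_le_Re_Im|].
    destruct (TR N) as [_ R1]. destruct (TI N) as [_ I1].
    rewrite <- Re_sum_n in R1. rewrite <- Im_sum_n in I1.
    change (Rabs (Series (fun n => Re (eval_term a P1 P2 P3 n)) - Re (sum_n (eval_term a P1 P2 P3) N))
          + Rabs (Series (fun n => Im (eval_term a P1 P2 P3 n)) - Im (sum_n (eval_term a P1 P2 P3) N))
          <= 16 * B * (2 * m / r) ^ S N).
    lra.
Qed.

(** 65 = 1 + 9 + 27 + 27 + 1 is the sum of the absolute values of the coefficients of [fG]; for r <=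
    1 each monomial costs at most r^3. *)
Lemma coef_bound_fG_mul (a : ps3) (r A : R) :
  0 <= r <= 1 -> coef_bound a r A -> coef_bound (ps_mul fG a) r (65 * r ^ 3 * A).
Proof.
  intros Hr Ha. assert (HA := coef_bound_nonneg a r A (proj1 Hr) Ha).
  assert (C9 : Cmod (RtoC (-9)) = 9) by (rewrite Cmod_R, Rabs_left; lra).
  assert (C27 : Cmod (RtoC 27) = 27) by (rewrite Cmod_R, Rabs_right; lra).
  assert (C27' : Cmod (RtoC (-27)) = 27) by (rewrite Cmod_R, Rabs_left; lra).
  assert (Hs := fun p q s => coef_bound_shift p q s a r A (proj1 Hr) Ha).
  rewrite fG_mul.
  apply coef_bound_weaken with (r ^ 3 * A + (Cmod (RtoC (-9)) * (r ^ 3 * A)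
    + (Cmod (RtoC 27) * (r ^ 3 * A) + (Cmod (RtoC (-27)) * (r ^ 3 * A) + r ^ 6 * A)))).
  - rewrite C9, C27, C27'.
    assert (r ^ 6 * A <= r ^ 3 * A); [|lra].
    apply Rmult_le_compat_r; [exact HA|].
    replace (r ^ 6) with (r ^ 3 * r ^ 3) by ring.
    assert (0 <= r ^ 3) by (apply pow_le; lra).
    assert (r ^ 3 <= 1 ^ 3) by (apply pow_incr; lra). nra.
  - repeat (apply coef_bound_add; [lra| |]); try apply coef_bound_scal;
      [exact (Hs 0 3 0)%nat | exact (Hs 0 2 1)%nat | exact (Hs 0 1 2)%nat
      | exact (Hs 0 0 3)%nat | exact (Hs 0 0 6)%nat].
Qed.

(** * Convergent division with remainder of degree at most 1 in x1 *)

Definition drop_x1_sq (a : ps3) : ps3 := fun i j k => a (S (S i)) j k.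

Lemma coef_bound_drop (a : ps3) (r A : R) :
  0 < r -> coef_bound a r A -> coef_bound (drop_x1_sq a) r (A / r ^ 2).
Proof.
  intros Hr Ha i j k. unfold drop_x1_sq.
  apply Rmult_le_reg_r with (r ^ 2); [now apply pow_lt|].
  replace (A / r ^ 2 * r ^ 2) with A by (field; lra).
  rewrite Rmult_assoc, <- pow_add. replace (i + j + k + 2)%nat with (S (S i) + j + k)%nat by lia.
  apply Ha.
Qed.

Lemma fG_mul_drop (a : ps3) :
  ps_mul fG (drop_x1_sq a) = drop_x1_sq (ps_mul fG a).
Proof.
  rewrite !fG_mul. apply ps_ext; intros i j k.
  unfold drop_x1_sq, ps_add, ps_scal, ps_shift. cbn [Nat.leb andb].
  rewrite !Nat.sub_0_r. reflexivity.
Qed.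

(** The quotient of [g] by [f = x1^2 + G] satisfies [q_i = g_(i+2) - G q_(i+2)].
    Iterating this converges in the [(x2, x3)]-adic topology. *)
Fixpoint quotient_approx (g : ps3) (n : nat) : ps3 :=
  match n with
  | O => ps_zero
  | S m => ps_sub (drop_x1_sq g) (ps_mul fG (drop_x1_sq (quotient_approx g m)))
  end.

(** The limit of the approximations, read off on a diagonal: coefficients with j + k < n are final
    from step n on, so the index S (j + k) is late enough. *)
Definition quotient (g : ps3) : ps3 := fun i j k => quotient_approx g (S (j + k)) i j k.

Lemma quotient_approx_stable (g : ps3) (n m i j k : nat) :
  (j + k < n)%nat -> (j + k < m)%nat ->
  quotient_approx g n i j k = quotient_approx g m i j k.
Proof.
  revert m i j k. induction n as [|n IH]; intros m i j k Hn Hm; [lia|].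
  destruct m as [|m]; [lia|]. simpl. unfold ps_sub. apply (f_equal (fun z => _ - z)%C).
  apply fG_mul_local. intros i' j' k' H. unfold drop_x1_sq. apply IH; lia.
Qed.

(** The recursion sends the bound 2 B / r^2 to (1 + 130 r) B / r^2, so it reproduces this bound once
    130 r <= 1. Being uniform in n, the bound passes to the limit. *)
Lemma coef_bound_quotient (g : ps3) (r B : R) :
  0 < r <= 1 / 130 -> coef_bound g r B -> coef_bound (quotient g) r (2 * (B / r ^ 2)).
Proof.
  intros Hr Hg.
  assert (HB : 0 <= B) by (apply (coef_bound_nonneg g r); lra || assumption).
  assert (HB2 : 0 <= B / r ^ 2) by (apply Rdiv_le_0_compat; [lra | apply pow_lt; lra]).
  assert (H : forall n, coef_bound (quotient_approx g n) r (2 * (B / r ^ 2))).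
  { induction n as [|n IH].
    - intros i j k. unfold quotient_approx, ps_zero. rewrite Cmod_0. lra.
    - cbn [quotient_approx]. apply coef_bound_weaken with
        (B / r ^ 2 + 65 * r ^ 3 * (2 * (B / r ^ 2) / r ^ 2)).
      + replace (65 * r ^ 3 * (2 * (B / r ^ 2) / r ^ 2)) with (130 * r * (B / r ^ 2))
          by (field; lra).
        assert (130 * r * (B / r ^ 2) <= 1 * (B / r ^ 2))
          by (apply Rmult_le_compat_r; [exact HB2 | lra]). lra.
      + apply coef_bound_sub; [lra | apply coef_bound_drop; [lra | assumption] |].
        apply coef_bound_fG_mul; [lra|]. apply coef_bound_drop; [lra | assumption]. }
  intros i j k. apply H.
Qed.

(** So g minus its quotient times f has degree at most 1 in x1, as [nilpotent_remainder] requires.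
    One step of the recursion involves the approximation of index j + k, which agrees with the limit
    in the degrees below j + k seen by [fG]. *)
Lemma quotient_spec (g : ps3) (i j k : nat) :
  ps_mul (quotient g) fD (S (S i)) j k = g (S (S i)) j k.
Proof.
  replace (ps_mul (quotient g) fD)
    with (ps_add (ps_shift 2 0 0 (quotient g)) (ps_mul fG (quotient g)))
    by (rewrite fD_eq, <- ps_mul_monomial; ring).
  unfold ps_add at 1, ps_shift. cbn [Nat.leb andb].
  rewrite !Nat.sub_0_r. replace (S (S i) - 2)%nat with i by lia.
  unfold quotient at 1. cbn [quotient_approx]. unfold ps_sub.
  rewrite fG_mul_drop. unfold drop_x1_sq.
  rewrite (fG_mul_local (quotient_approx g (j + k)) (quotient g)).
  - ring.
  - intros i' j' k' H. unfold quotient. apply quotient_approx_stable; lia.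
Qed.

Lemma fD_reduced : reduced fD.
Proof.
  intros g n Hg [p [_ Hp]].
  destruct (convergent_coef_bound g Hg) as [r [B [Hr HB]]].
  exists (quotient g). split.
  - set (r' := Rmin r (1 / 130)).
    assert (0 < r' <= r /\ r' <= 1 / 130).
    { unfold r'. repeat split; [apply Rmin_glb_lt; lra | apply Rmin_l | apply Rmin_r]. }
    apply coef_bound_convergent with r' (2 * (B / r' ^ 2)); [lra|].
    apply coef_bound_quotient; [lra|]. apply coef_bound_le with r; [lra | assumption].
  - assert (E : g = ps_mul (quotient g) fD); [|now rewrite <- E].
    set (rem := ps_sub g (ps_mul (quotient g) fD)).
    (* The coefficient of x1^n in the remainder, as a series not involving x1. *)
    set (part := fun n : nat => (fun i j k => if Nat.eqb i 0 then rem n j k else RtoC 0) : ps3).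
    apply (nilpotent_remainder (part 0%nat) (part 1%nat) (quotient g) p g n).
    + intros i j k. reflexivity.
    + intros i j k. reflexivity.
    + replace (ps_add (part 0%nat) (ps_mul X1 (part 1%nat))) with rem.
      * unfold rem. ring.
      * unfold X1. rewrite ps_mul_monomial. apply ps_ext; intros [|[|i]] j k;
          unfold ps_add, ps_shift, part; cbn [Nat.leb andb Nat.sub Nat.eqb];
          rewrite ?Nat.sub_0_r; try ring.
        unfold rem, ps_sub. rewrite quotient_spec. ring.
    + now apply ps_ext.
Qed.

Lemma coef_bound_fG (r : R) : 0 <= r <= 1 -> coef_bound fG r (65 * r ^ 3).
Proof.
  intro Hr. replace fG with (ps_mul fG ps_one) by ring.
  rewrite <- (Rmult_1_r (65 * r ^ 3)). apply coef_bound_fG_mul; [exact Hr|].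
  apply coef_bound_one.
Qed.

Lemma fD_convergent : convergent fD.
Proof.
  apply coef_bound_convergent with 1 (1 ^ (2 + 0 + 0) + 65 * 1 ^ 3); [lra|].
  rewrite fD_eq. apply coef_bound_add; [lra | apply coef_bound_monomial; lra|].
  apply coef_bound_fG; lra.
Qed.

Lemma monomial_convergent (p q s : nat) : convergent (ps_monomial p q s).
Proof.
  apply coef_bound_convergent with 1 (1 ^ (p + q + s)); [lra|].
  apply coef_bound_monomial; lra.
Qed.

(** * The singular locus *)

Ltac has_eval_polynomial :=
  repeat match goal with
  | |- has_eval (ps_add _ _) _ _ _ _ => apply has_eval_add
  | |- has_eval (ps_scal _ _) _ _ _ _ => apply has_eval_scal
  | |- has_eval (ps_monomial _ _ _) _ _ _ _ => apply has_eval_monomial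
  end.

Lemma has_eval_fD (P1 P2 P3 : C) :
  has_eval fD P1 P2 P3 (P1 ^ 2 + (P2 - RtoC 3 * P3) ^ 3 + P3 ^ 6)%C.
Proof.
  rewrite fD_eq. unfold fG.
  replace (P1 ^ 2 + (P2 - RtoC 3 * P3) ^ 3 + P3 ^ 6)%C with
   (P1 ^ 2 * P2 ^ 0 * P3 ^ 0 + (P1 ^ 0 * P2 ^ 3 * P3 ^ 0 +
     (RtoC (-9) * (P1 ^ 0 * P2 ^ 2 * P3 ^ 1) + (RtoC 27 * (P1 ^ 0 * P2 ^ 1 * P3 ^ 2)
      + (RtoC (-27) * (P1 ^ 0 * P2 ^ 0 * P3 ^ 3) + P1 ^ 0 * P2 ^ 0 * P3 ^ 6)))))%C.
  - has_eval_polynomial.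
  - replace (RtoC (-9)) with (- (RtoC 3 * RtoC 3))%C
      by (rewrite <- RtoC_mult, <- RtoC_opp; f_equal; lra).
    replace (RtoC (-27)) with (- (RtoC 3 * RtoC 3 * RtoC 3))%C
      by (rewrite <- !RtoC_mult, <- RtoC_opp; f_equal; lra).
    replace (RtoC 27) with (RtoC 3 * RtoC 3 * RtoC 3)%C
      by (rewrite <- !RtoC_mult; f_equal; lra).
    replace (RtoC 3) with (RtoC 1 + RtoC 1 + RtoC 1)%C
      by (rewrite <- !RtoC_plus; f_equal; lra).
    ring.
Qed.

Lemma ps_d1_add (a b : ps3) : ps_d1 (ps_add a b) = ps_add (ps_d1 a) (ps_d1 b).
Proof. apply ps_ext; intros. apply Cmult_plus_distr_l. Qed.

Lemma ps_d2_add (a b : ps3) : ps_d2 (ps_add a b) = ps_add (ps_d2 a) (ps_d2 b).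
Proof. apply ps_ext; intros. apply Cmult_plus_distr_l. Qed.

Lemma ps_d3_add (a b : ps3) : ps_d3 (ps_add a b) = ps_add (ps_d3 a) (ps_d3 b).
Proof. apply ps_ext; intros. apply Cmult_plus_distr_l. Qed.

Lemma ps_d1_scal (c : C) (a : ps3) : ps_d1 (ps_scal c a) = ps_scal c (ps_d1 a).
Proof. apply ps_ext; intros. unfold ps_d1, ps_scal. ring. Qed.

Lemma ps_d2_scal (c : C) (a : ps3) : ps_d2 (ps_scal c a) = ps_scal c (ps_d2 a).
Proof. apply ps_ext; intros. unfold ps_d2, ps_scal. ring. Qed.

Lemma ps_d3_scal (c : C) (a : ps3) : ps_d3 (ps_scal c a) = ps_scal c (ps_d3 a).
Proof. apply ps_ext; intros. unfold ps_d3, ps_scal. ring. Qed.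

(** For p = 0 the truncated exponent p - 1 is harmless, because the scalar factor is 0. *)
Lemma ps_d1_monomial (p q s : nat) :
  ps_d1 (ps_monomial p q s) = ps_scal (RtoC (INR p)) (ps_monomial (p - 1) q s).
Proof.
  apply ps_ext; intros i j k. unfold ps_d1, ps_scal, ps_monomial.
  destruct p as [|p]; cbn [Nat.eqb andb].
  - change (INR 0) with 0. ring.
  - rewrite Nat.sub_succ, Nat.sub_0_r.
    destruct (Nat.eqb_spec i p) as [->|_]; cbn [andb]; [reflexivity | ring].
Qed.

Lemma ps_d2_monomial (p q s : nat) :
  ps_d2 (ps_monomial p q s) = ps_scal (RtoC (INR q)) (ps_monomial p (q - 1) s).
Proof.
  apply ps_ext; intros i j k. unfold ps_d2, ps_scal, ps_monomial.
  destruct (Nat.eqb i p); cbn [andb]; [|ring].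
  destruct q as [|q]; cbn [Nat.eqb andb].
  - change (INR 0) with 0. ring.
  - rewrite Nat.sub_succ, Nat.sub_0_r.
    destruct (Nat.eqb_spec j q) as [->|_]; cbn [andb]; [reflexivity | ring].
Qed.

Lemma ps_d3_monomial (p q s : nat) :
  ps_d3 (ps_monomial p q s) = ps_scal (RtoC (INR s)) (ps_monomial p q (s - 1)).
Proof.
  apply ps_ext; intros i j k. unfold ps_d3, ps_scal, ps_monomial.
  destruct (Nat.eqb i p); cbn [andb]; [|ring].
  destruct (Nat.eqb j q); cbn [andb]; [|ring].
  destruct s as [|s]; cbn [Nat.eqb andb].
  - change (INR 0) with 0. ring.
  - rewrite Nat.sub_succ, Nat.sub_0_r.
    destruct (Nat.eqb_spec k s) as [->|_]; cbn [andb]; [reflexivity | ring].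
Qed.

Lemma ps_scal_scal (c d : C) (a : ps3) : ps_scal c (ps_scal d a) = ps_scal (c * d)%C a.
Proof. apply ps_ext; intros. unfold ps_scal. ring. Qed.

Lemma ps_scal_0 (a : ps3) : ps_scal (RtoC 0) a = ps_zero.
Proof. apply ps_ext; intros. unfold ps_scal. apply Cmult_0_l. Qed.

Lemma ps_d1_fD : ps_d1 fD = (RtoC 2 *: ps_monomial 1 0 0)%ps.
Proof.
  rewrite fD_eq. unfold fG.
  rewrite !ps_d1_add, !ps_d1_scal, !ps_d1_monomial, !ps_scal_scal.
  cbn [Nat.sub]. change (INR 0) with 0. rewrite !Cmult_0_r, !ps_scal_0.
  change (INR 2) with 2. ring.
Qed.

Lemma ps_d2_fD : ps_d2 fD =
  (RtoC 3 *: ps_monomial 0 2 0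
   + (RtoC (-18) *: ps_monomial 0 1 1 + RtoC 27 *: ps_monomial 0 0 2))%ps.
Proof.
  rewrite fD_eq. unfold fG.
  rewrite !ps_d2_add, !ps_d2_scal, !ps_d2_monomial, !ps_scal_scal, <- !RtoC_mult.
  cbn [Nat.sub].
  replace (INR 3) with 3 by (simpl; lra).
  replace (-9 * INR 2) with (-18) by (simpl; lra).
  replace (27 * INR 1) with 27 by (simpl; lra).
  replace (-27 * INR 0) with 0 by (simpl; lra). change (INR 0) with 0.
  rewrite !ps_scal_0. ring.
Qed.

Lemma ps_d3_fD : ps_d3 fD =
  (RtoC (-9) *: ps_monomial 0 2 0
   + (RtoC 54 *: ps_monomial 0 1 1
   + (RtoC (-81) *: ps_monomial 0 0 2 + RtoC 6 *: ps_monomial 0 0 5)))%ps.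
Proof.
  rewrite fD_eq. unfold fG.
  rewrite !ps_d3_add, !ps_d3_scal, !ps_d3_monomial, !ps_scal_scal, <- !RtoC_mult.
  cbn [Nat.sub].
  replace (-9 * INR 1) with (-9) by (simpl; lra).
  replace (27 * INR 2) with 54 by (simpl; lra).
  replace (-27 * INR 3) with (-81) by (simpl; lra).
  replace (INR 6) with 6 by (simpl; lra). change (INR 0) with 0.
  rewrite !ps_scal_0. ring.
Qed.

Lemma has_eval_d1_fD (P1 P2 P3 : C) :
  has_eval (ps_d1 fD) P1 P2 P3 (RtoC 2 * P1)%C.
Proof.
  rewrite ps_d1_fD.
  replace (RtoC 2 * P1)%C with (RtoC 2 * (P1 ^ 1 * P2 ^ 0 * P3 ^ 0))%C by ring.
  apply has_eval_scal, has_eval_monomial.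
Qed.

Lemma has_eval_d2_fD (P1 P2 P3 : C) :
  has_eval (ps_d2 fD) P1 P2 P3 (RtoC 3 * (P2 - RtoC 3 * P3) ^ 2)%C.
Proof.
  rewrite ps_d2_fD.
  replace (RtoC 3 * (P2 - RtoC 3 * P3) ^ 2)%C with
    (RtoC 3 * (P1 ^ 0 * P2 ^ 2 * P3 ^ 0) + (RtoC (-18) * (P1 ^ 0 * P2 ^ 1 * P3 ^ 1)
     + RtoC 27 * (P1 ^ 0 * P2 ^ 0 * P3 ^ 2)))%C.
  - has_eval_polynomial.
  - replace (RtoC (-18)) with (- (RtoC 2 * RtoC 3 * RtoC 3))%C
      by (rewrite <- !RtoC_mult, <- RtoC_opp; f_equal; lra).
    replace (RtoC 27) with (RtoC 3 * RtoC 3 * RtoC 3)%C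
      by (rewrite <- !RtoC_mult; f_equal; lra).
    replace (RtoC 2) with (RtoC 1 + RtoC 1)%C by (rewrite <- !RtoC_plus; f_equal; lra).
    ring.
Qed.

Lemma has_eval_d3_fD (P1 P2 P3 : C) :
  has_eval (ps_d3 fD) P1 P2 P3
    (RtoC (-9) * (P2 - RtoC 3 * P3) ^ 2 + RtoC 6 * P3 ^ 5)%C.
Proof.
  rewrite ps_d3_fD.
  replace (RtoC (-9) * (P2 - RtoC 3 * P3) ^ 2 + RtoC 6 * P3 ^ 5)%C with
    (RtoC (-9) * (P1 ^ 0 * P2 ^ 2 * P3 ^ 0) + (RtoC 54 * (P1 ^ 0 * P2 ^ 1 * P3 ^ 1)
     + (RtoC (-81) * (P1 ^ 0 * P2 ^ 0 * P3 ^ 2) + RtoC 6 * (P1 ^ 0 * P2 ^ 0 * P3 ^ 5))))%C.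
  - has_eval_polynomial.
  - replace (RtoC (-9)) with (- (RtoC 3 * RtoC 3))%C
      by (rewrite <- !RtoC_mult, <- RtoC_opp; f_equal; lra).
    replace (RtoC 54) with (RtoC 2 * (RtoC 3 * RtoC 3 * RtoC 3))%C
      by (rewrite <- !RtoC_mult; f_equal; lra).
    replace (RtoC (-81)) with (- (RtoC 3 * RtoC 3 * (RtoC 3 * RtoC 3)))%C
      by (rewrite <- !RtoC_mult, <- RtoC_opp; f_equal; lra).
    replace (RtoC 2) with (RtoC 1 + RtoC 1)%C by (rewrite <- !RtoC_plus; f_equal; lra).
    ring.
Qed.

Lemma Cpow_eq_0 (z : C) (n : nat) : (z ^ n)%C = RtoC 0 -> z = RtoC 0.
Proof.
  intro H. apply Cmod_eq_0. apply (f_equal Cmod) in H. rewrite Cmod_pow, Cmod_0 in H.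
  apply NNPP. intro H'. now apply (pow_nonzero _ n) in H'.
Qed.

Lemma RtoC_neq_0 (x : R) : x <> 0 -> RtoC x <> RtoC 0.
Proof. intros H E. apply H. now apply RtoC_inj. Qed.

Lemma Cmult_eq_0 (x y : C) : (x * y)%C = RtoC 0 -> x <> RtoC 0 -> y = RtoC 0.
Proof. intros H Hx. apply NNPP. intro Hy. now apply (Cmult_neq_0 x y). Qed.

Lemma fD_isolated : isolated_singularity fD.
Proof.
  (* The origin is the only critical point of f in the whole space, so any radius works. *)
  exists 1. split; [lra|]. intros [[P1 P2] P3] _. unfold singular_point, hypersurface.
  rewrite (has_eval_eq _ _ _ _ _ (has_eval_fD P1 P2 P3)),
    (has_eval_eq _ _ _ _ _ (has_eval_d1_fD P1 P2 P3)),
    (has_eval_eq _ _ _ _ _ (has_eval_d2_fD P1 P2 P3)),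
    (has_eval_eq _ _ _ _ _ (has_eval_d3_fD P1 P2 P3)).
  split.
  - intros [_ [H1 [H2 H3]]].
    apply Cmult_eq_0 in H1; [|apply RtoC_neq_0; lra].
    apply Cmult_eq_0 in H2; [|apply RtoC_neq_0; lra].
    rewrite H2, Cmult_0_r, Cplus_0_l in H3. apply Cpow_eq_0 in H2.
    apply Cmult_eq_0 in H3; [|apply RtoC_neq_0; lra]. apply Cpow_eq_0 in H3.
    subst P3. replace P2 with (P2 - RtoC 3 * RtoC 0)%C by ring. now rewrite H1, H2.
  - intros [= -> -> ->]. repeat split; ring.
Qed.

(** * Weighted homogeneity *)

Definition fD_normal_form : ps3 := (ps_monomial 2 0 0 + ps_monomial 0 3 0 + ps_monomial 0 0 6)%ps.

Lemma ps_euler_monomial (p q s : nat) (w1 w2 w3 d : R) :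
  w1 * INR p + w2 * INR q + w3 * INR s = d ->
  (RtoC w1 *: (X1 * ps_d1 (ps_monomial p q s)) + RtoC w2 *: (X2 * ps_d2 (ps_monomial p q s))
   + RtoC w3 *: (X3 * ps_d3 (ps_monomial p q s)))%ps = (RtoC d *: ps_monomial p q s)%ps.
Proof.
  intros <-.
  assert (E1 : (X1 * ps_d1 (ps_monomial p q s) = RtoC (INR p) *: ps_monomial p q s)%ps).
  { rewrite ps_d1_monomial. destruct p as [|p].
    - change (INR 0) with 0. rewrite !ps_scal_0. ring.
    - rewrite ps_scal_cst, (ps_scal_cst (RtoC (INR (S p)))).
      replace (ps_monomial (S p) q s) with (X1 * ps_monomial (S p - 1) q s)%ps; [ring|].
      unfold X1. rewrite ps_monomial_mul. f_equal. lia. }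
  assert (E2 : (X2 * ps_d2 (ps_monomial p q s) = RtoC (INR q) *: ps_monomial p q s)%ps).
  { rewrite ps_d2_monomial. destruct q as [|q].
    - change (INR 0) with 0. rewrite !ps_scal_0. ring.
    - rewrite ps_scal_cst, (ps_scal_cst (RtoC (INR (S q)))).
      replace (ps_monomial p (S q) s) with (X2 * ps_monomial p (S q - 1) s)%ps; [ring|].
      unfold X2. rewrite ps_monomial_mul. f_equal. lia. }
  assert (E3 : (X3 * ps_d3 (ps_monomial p q s) = RtoC (INR s) *: ps_monomial p q s)%ps).
  { rewrite ps_d3_monomial. destruct s as [|s].
    - change (INR 0) with 0. rewrite !ps_scal_0. ring.
    - rewrite ps_scal_cst, (ps_scal_cst (RtoC (INR (S s)))).
      replace (ps_monomial p q (S s)) with (X3 * ps_monomial p q (S s - 1))%ps; [ring|].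
      unfold X3. rewrite ps_monomial_mul. f_equal. lia. }
  rewrite E1, E2, E3. apply ps_ext; intros. unfold ps_add, ps_scal.
  rewrite !RtoC_plus, !RtoC_mult. ring.
Qed.

Lemma fD_normal_form_weighted_homogeneous : weighted_homogeneous fD_normal_form.
Proof.
  exists 3, 2, 1, 6. repeat (split; [lra|]). unfold fD_normal_form.
  rewrite !ps_d1_add, !ps_d2_add, !ps_d3_add.
  assert (E1 := ps_euler_monomial 2 0 0 3 2 1 6 ltac:(simpl; lra)).
  assert (E2 := ps_euler_monomial 0 3 0 3 2 1 6 ltac:(simpl; lra)).
  assert (E3 := ps_euler_monomial 0 0 6 3 2 1 6 ltac:(simpl; lra)).
  assert (A : forall c a b, ps_scal c (ps_add a b) = ps_add (ps_scal c a) (ps_scal c b)).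
  { intros. apply ps_ext; intros. unfold ps_scal, ps_add. ring. }
  rewrite !A, <- E1, <- E2, <- E3, !ps_scal_cst.
  match goal with |- (?x == ?y)%ps => enough (x = y) as -> by easy end. ring.
Qed.

(** * Substitution of series without constant term *)

Definition order_ge (n : nat) (a : ps3) : Prop :=
  forall i j k, (i + j + k < n)%nat -> a i j k = RtoC 0.

Lemma order_ge_mul (a b : ps3) (n m : nat) :
  order_ge n a -> order_ge m b -> order_ge (n + m) (ps_mul a b).
Proof.
  intros Ha Hb i j k H. unfold ps_mul.
  apply sum_n_C0; intros p Hp; apply sum_n_C0; intros q Hq; apply sum_n_C0; intros s Hs.
  destruct (Nat.lt_ge_cases (p + q + s) n).
  - rewrite Ha by assumption. apply Cmult_0_l.
  - rewrite Hb by lia. apply Cmult_0_r.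
Qed.

Lemma order_ge_pow (a : ps3) (n : nat) : order_ge 1 a -> order_ge n (ps_pow a n).
Proof.
  intro Ha. induction n as [|n IH]; simpl.
  - intros i j k H. lia.
  - apply (order_ge_mul a (ps_pow a n) 1 n); assumption.
Qed.

Lemma ps_comp_add (a b y1 y2 y3 : ps3) :
  ps_comp (ps_add a b) y1 y2 y3 = ps_add (ps_comp a y1 y2 y3) (ps_comp b y1 y2 y3).
Proof.
  apply ps_ext; intros p q s. unfold ps_comp, ps_add at 2.
  rewrite <- (sum_n_plus (G := C_AbelianMonoid)). apply sum_n_ext; intro n.
  rewrite <- (sum_deg_plus (G := C_AbelianMonoid)). unfold sum_deg.
  apply sum_n_ext; intro i. apply sum_n_ext; intro j.
  unfold ps_add at 1. apply Cmult_plus_distr_r.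
Qed.

(** The terms cut off in the definition of [ps_comp] have too high an order to contribute. *)
Lemma ps_comp_monomial (u v w : nat) (y1 y2 y3 : ps3) :
  order_ge 1 y1 -> order_ge 1 y2 -> order_ge 1 y3 ->
  ps_comp (ps_monomial u v w) y1 y2 y3 = (y1 ^ u * y2 ^ v * y3 ^ w)%ps.
Proof.
  intros H1 H2 H3. apply ps_ext; intros p q s. unfold ps_comp.
  set (Y := fun i j k => (y1 ^ i * y2 ^ j * y3 ^ k)%ps).
  set (t := fun i j k => (ps_monomial u v w i j k * Y i j k p q s)%C).
  change (sum_n (sum_deg t) (p + q + s) = Y u v w p q s).
  assert (T0 : forall n, n <> (u + v + w)%nat -> sum_deg t n = RtoC 0).
  { intros n Hn. apply sum_n_C0; intros i Hi; apply sum_n_C0; intros j Hj. unfold t.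
    rewrite ps_monomial_neq by (intros [= ]; lia). apply Cmult_0_l. }
  destruct (Nat.lt_ge_cases (p + q + s) (u + v + w)) as [H|H].
  - rewrite sum_n_C0 by (intros; apply T0; lia). symmetry. unfold Y.
    refine (order_ge_mul _ _ (u + v) w _ _ p q s H); [apply order_ge_mul|];
      now apply order_ge_pow.
  - rewrite (sum_n_single _ (u + v + w)) by (auto; lia). unfold sum_deg.
    rewrite (sum_n_single _ u).
    + rewrite (sum_n_single _ v).
      * replace (u + v + w - u - v)%nat with w by lia. unfold t.
        rewrite ps_monomial_eq. apply Cmult_1_l.
      * lia.
      * intros j Hj Hne. unfold t. rewrite ps_monomial_neq by congruence. apply Cmult_0_l.
    + lia.
    + intros i Hi Hne. apply sum_n_C0; intros j Hj. unfold t.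
      rewrite ps_monomial_neq by congruence. apply Cmult_0_l.
Qed.

Lemma order_ge_monomial (p q s : nat) : order_ge (p + q + s) (ps_monomial p q s).
Proof. intros i j k H. apply ps_monomial_neq. intros [= ]. lia. Qed.

Lemma fD_weighted_homogeneous_in :
  weighted_homogeneous_in X1 (X2 - RtoC 3 *: X3)%ps X3 fD.
Proof.
  split.
  - unfold coordinates. split; [apply monomial_convergent|]. split.
    { apply coef_bound_convergent with 1 (1 ^ (0 + 1 + 0) + Cmod (RtoC 3) * 1 ^ (0 + 0 + 1));
        [lra|].
      apply coef_bound_sub; [lra | |apply coef_bound_scal]; apply coef_bound_monomial; lra. }
    split; [apply monomial_convergent|].
    split; [reflexivity|]. split.
    { unfold ps_sub, ps_scal, X2, X3, ps_monomial. cbn [Nat.eqb andb]. ring. }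
    split; [reflexivity|].
    unfold ps_mul, ps_add, ps_sub, ps_scal, ps_d1, ps_d2, ps_d3, X1, X2, X3, ps_monomial.
    rewrite !sum_O. cbn [Nat.eqb andb Nat.sub]. change (INR 1) with 1.
    intro E. apply (f_equal fst) in E. simpl in E. lra.
  - exists fD_normal_form. split; [|split].
    + apply coef_bound_convergent with 1 (1 ^ (2 + 0 + 0) + 1 ^ (0 + 3 + 0) + 1 ^ (0 + 0 + 6));
        [lra|].
      repeat (apply coef_bound_add; [lra | |]); apply coef_bound_monomial; lra.
    + assert (O1 := order_ge_monomial 1 0 0).
      assert (O2 : order_ge 1 (X2 - RtoC 3 *: X3)%ps).
      { intros i j k H. unfold ps_sub, ps_scal, X2, X3.
        rewrite (order_ge_monomial 0 1 0) by exact H.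
        rewrite (order_ge_monomial 0 0 1) by exact H. ring. }
      assert (O3 := order_ge_monomial 0 0 1).
      unfold fD_normal_form.
      rewrite !ps_comp_add, !(ps_comp_monomial _ _ _ X1 _ X3) by assumption.
      match goal with |- (?x == ?y)%ps => enough (x = y) as -> by easy end.
      unfold fD. cbn [ps_pow]. ring.
    + exact fD_normal_form_weighted_homogeneous.
Qed.

(** * Low order terms of a logarithmic vector field *)

(** At numerical i, j, k the shifts compute, leaving a linear relation between finitely many
    coefficients. *)
Lemma log_equation_coef (nu1 nu2 nu3 h : ps3) (i j k : nat) :
  (nu1 * ps_d1 fD + nu2 * ps_d2 fD + nu3 * ps_d3 fD == h * fD)%ps ->
  (RtoC 2 * ps_shift 1 0 0 nu1 i j k
   + (RtoC 3 * ps_shift 0 2 0 nu2 i j k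
      + (RtoC (-18) * ps_shift 0 1 1 nu2 i j k + RtoC 27 * ps_shift 0 0 2 nu2 i j k))
   + (RtoC (-9) * ps_shift 0 2 0 nu3 i j k
      + (RtoC 54 * ps_shift 0 1 1 nu3 i j k
         + (RtoC (-81) * ps_shift 0 0 2 nu3 i j k + RtoC 6 * ps_shift 0 0 5 nu3 i j k)))
   = ps_shift 2 0 0 h i j k
     + (ps_shift 0 3 0 h i j k
        + (RtoC (-9) * ps_shift 0 2 1 h i j k
           + (RtoC 27 * ps_shift 0 1 2 h i j k
              + (RtoC (-27) * ps_shift 0 0 3 h i j k + ps_shift 0 0 6 h i j k)))))%C.
Proof.
  intro H. specialize (H i j k).
  replace (nu1 * ps_d1 fD)%ps with (ps_d1 fD * nu1)%ps in H by ring.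
  replace (nu2 * ps_d2 fD)%ps with (ps_d2 fD * nu2)%ps in H by ring.
  replace (nu3 * ps_d3 fD)%ps with (ps_d3 fD * nu3)%ps in H by ring.
  replace (h * fD)%ps with (ps_monomial 2 0 0 * h + fG * h)%ps in H
    by (rewrite fD_eq; ring).
  rewrite ps_d1_fD, ps_d2_fD, ps_d3_fD, fG_mul in H.
  rewrite !ps_mul_add_l, !ps_mul_scal_l, !ps_mul_monomial in H.
  exact H.
Qed.

(** In the coordinates [v = x2 - 3 x3], [w = x3] the equation reads
    [2 x1 a + 3 v^2 b + 6 w^5 c = h (x1^2 + v^3 + w^6)] with [a = nu1],
    [b = nu2 - 3 nu3], [c = nu3].  The relations follow by comparing coefficients:
    [b] and its linear part from degrees 2 and 3 at [x1 = 0], [c] and its linear part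
    from degrees 5 and 6 modulo [v^2], and [a] from the coefficients of [x1] and
    [x1^2] modulo [v^2]. *)
Lemma log_low_order_linear (nu1 nu2 nu3 h : ps3) (L : C -> R) :
  (forall x y, L (x + y)%C = L x + L y) ->
  (forall (c : R) x, L (c * x)%C = c * L x) ->
  (nu1 * ps_d1 fD + nu2 * ps_d2 fD + nu3 * ps_d3 fD == h * fD)%ps ->
  let l := L (h 0 0 0)%nat in
  L (nu1 0 0 0)%nat = 0 /\ L (nu2 0 0 0)%nat = 0 /\ L (nu3 0 0 0)%nat = 0 /\
  L (nu1 1 0 0)%nat = l / 2 /\
  L (nu1 0 0 3)%nat + 3 * L (nu1 0 1 2)%nat + 9 * L (nu1 0 2 1)%nat
    + 27 * L (nu1 0 3 0)%nat = 0 /\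
  L (nu2 0 1 0)%nat = l / 3 /\ L (nu2 0 0 1)%nat = - l / 2 /\
  L (nu3 0 1 0)%nat = 0 /\ L (nu3 0 0 1)%nat = l / 6.
Proof.
  intros LD LZ H l. subst l.
  assert (L0 : L (RtoC 0) = 0).
  { replace (RtoC 0) with (RtoC 0 * RtoC 0)%C by ring. rewrite LZ. lra. }
  (* [L] will be [Re] and [Im]: it turns the complex relations into real ones, which [lra] can
     solve. *)
  assert (E := fun i j k => f_equal L (log_equation_coef nu1 nu2 nu3 h i j k H)).
  (* Setting v = 0 in a homogeneous part amounts to weighting its coefficients by powers of 3, since
     x2 = 3 x3 there. Thus the cubic relation for [nu1] is [E103], [E112], [E121], [E130] with
     weights 1, 3, 9, 27; it is the coefficient of w^3 in nu1(0, 3 w, w). *)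
  assert (E100 := (E 1 0 0)%nat). assert (E200 := (E 2 0 0)%nat).
  assert (E103 := (E 1 0 3)%nat). assert (E112 := (E 1 1 2)%nat).
  assert (E121 := (E 1 2 1)%nat). assert (E130 := (E 1 3 0)%nat).
  assert (E020 := (E 0 2 0)%nat). assert (E030 := (E 0 3 0)%nat). assert (E021 := (E 0 2 1)%nat).
  assert (E005 := (E 0 0 5)%nat). assert (E014 := (E 0 1 4)%nat). assert (E023 := (E 0 2 3)%nat).
  assert (E032 := (E 0 3 2)%nat). assert (E041 := (E 0 4 1)%nat). assert (E050 := (E 0 5 0)%nat).
  assert (E006 := (E 0 0 6)%nat). assert (E015 := (E 0 1 5)%nat). assert (E024 := (E 0 2 4)%nat).
  assert (E033 := (E 0 3 3)%nat). assert (E042 := (E 0 4 2)%nat). assert (E051 := (E 0 5 1)%nat).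
  assert (E060 := (E 0 6 0)%nat).
  clear E. unfold ps_shift in *. cbn [Nat.leb andb Nat.sub] in *.
  rewrite ?LD, ?LZ, ?L0 in *.
  repeat split; lra.
Qed.

Lemma log_low_order (nu1 nu2 nu3 h : ps3) :
  (nu1 * ps_d1 fD + nu2 * ps_d2 fD + nu3 * ps_d3 fD == h * fD)%ps ->
  let l := h 0%nat 0%nat 0%nat in
  nu1 0%nat 0%nat 0%nat = RtoC 0 /\ nu2 0%nat 0%nat 0%nat = RtoC 0 /\
  nu3 0%nat 0%nat 0%nat = RtoC 0 /\
  nu1 1%nat 0%nat 0%nat = (RtoC (/ 2) * l)%C /\
  (nu1 0%nat 0%nat 3%nat + RtoC 3 * nu1 0%nat 1%nat 2%nat + RtoC 9 * nu1 0%nat 2%nat 1%nat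
   + RtoC 27 * nu1 0%nat 3%nat 0%nat)%C = RtoC 0 /\
  nu2 0%nat 1%nat 0%nat = (RtoC (/ 3) * l)%C /\
  nu2 0%nat 0%nat 1%nat = (RtoC (- / 2) * l)%C /\
  nu3 0%nat 1%nat 0%nat = RtoC 0 /\
  nu3 0%nat 0%nat 1%nat = (RtoC (/ 6) * l)%C.
Proof.
  intros H l.
  assert (LR : forall (c : R) x, Re (c * x)%C = c * Re x) by (intros; simpl; unfold Re; ring).
  assert (LI : forall (c : R) x, Im (c * x)%C = c * Im x) by (intros; simpl; unfold Im; ring).
  assert (DR : forall x y, Re (x + y)%C = Re x + Re y) by reflexivity.
  assert (DI : forall x y, Im (x + y)%C = Im x + Im y) by reflexivity.
  destruct (log_low_order_linear nu1 nu2 nu3 h Re DR LR H)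
    as [R1 [R2 [R3 [R4 [R5 [R6 [R7 [R8 R9]]]]]]]].
  destruct (log_low_order_linear nu1 nu2 nu3 h Im DI LI H)
    as [I1 [I2 [I3 [I4 [I5 [I6 [I7 [I8 I9]]]]]]]].
  assert (X : forall x y : C, Re x = Re y -> Im x = Im y -> x = y).
  { intros [x1 x2] [y1 y2]. unfold Re, Im. simpl. congruence. }
  fold l in R4, R6, R7, R9, I4, I6, I7, I9.
  repeat split; apply X; rewrite ?DR, ?DI, ?LR, ?LI;
    change (Re (RtoC 0)) with 0; change (Im (RtoC 0)) with 0; lra.
Qed.

(** * Power series along paths *)

Definition C_continuity_pt (g : R -> C) (t : R) : Prop :=
  continuity_pt (fun x => Re (g x)) t /\ continuity_pt (fun x => Im (g x)) t.

Lemma C_continuity_pt_const (c : C) (t : R) : C_continuity_pt (fun _ => c) t.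
Proof. split; now apply continuity_pt_const. Qed.

Lemma C_continuity_pt_plus (f g : R -> C) (t : R) :
  C_continuity_pt f t -> C_continuity_pt g t -> C_continuity_pt (fun x => (f x + g x)%C) t.
Proof.
  intros [F1 F2] [G1 G2]. split.
  - exact (continuity_pt_plus _ _ _ F1 G1).
  - exact (continuity_pt_plus _ _ _ F2 G2).
Qed.

Lemma C_continuity_pt_mult (f g : R -> C) (t : R) :
  C_continuity_pt f t -> C_continuity_pt g t -> C_continuity_pt (fun x => (f x * g x)%C) t.
Proof.
  intros [F1 F2] [G1 G2]. split.
  - exact (continuity_pt_minus _ _ _ (continuity_pt_mult _ _ _ F1 G1)
                                     (continuity_pt_mult _ _ _ F2 G2)).
  - exact (continuity_pt_plus _ _ _ (continuity_pt_mult _ _ _ F1 G2)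
                                    (continuity_pt_mult _ _ _ F2 G1)).
Qed.

Lemma C_continuity_pt_conj (f : R -> C) (t : R) :
  C_continuity_pt f t -> C_continuity_pt (fun x => Cconj (f x)) t.
Proof.
  intros [F1 F2]. split; [exact F1 | exact (continuity_pt_opp _ _ F2)].
Qed.

Lemma C_continuity_pt_pow (f : R -> C) (n : nat) (t : R) :
  C_continuity_pt f t -> C_continuity_pt (fun x => (f x ^ n)%C) t.
Proof.
  intro H. induction n as [|n IH]; simpl.
  - apply C_continuity_pt_const.
  - now apply C_continuity_pt_mult.
Qed.

(** The predicate is arbitrary because partial sums are used for two purposes: continuity along
    paths and vanishing mean. *)
Lemma sum_n_pointwise_ind (Pr : (R -> C) -> Prop) (u : nat -> R -> C) (n : nat) :
  (forall f g, Pr f -> Pr g -> Pr (fun x => (f x + g x)%C)) ->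
  (forall i, (i <= n)%nat -> Pr (u i)) -> Pr (fun x => sum_n (fun i => u i x) n).
Proof.
  intros Hp. induction n as [|n IH]; intro Hu.
  - replace (fun x => sum_n (fun i => u i x) 0) with (u 0%nat); [apply Hu; lia|].
    apply functional_extensionality; intro x. now rewrite sum_O.
  - replace (fun x => sum_n (fun i => u i x) (S n))
      with (fun x => (sum_n (fun i => u i x) n + u (S n) x)%C).
    + apply Hp; [apply IH; intros; apply Hu; lia | apply Hu; lia].
    + apply functional_extensionality; intro x. now rewrite sum_Sn.
Qed.

Lemma partial_eval_ind (Pr : (R -> C) -> Prop) (a : ps3) (P1 P2 P3 : R -> C) (N : nat) :
  (forall f g, Pr f -> Pr g -> Pr (fun x => (f x + g x)%C)) ->
  (forall i j k, Pr (fun x => (a i j k * (P1 x ^ i * P2 x ^ j * P3 x ^ k))%C)) ->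
  Pr (fun x => sum_n (eval_term a (P1 x) (P2 x) (P3 x)) N).
Proof.
  intros Hp Ht.
  apply (sum_n_pointwise_ind Pr (fun n x => eval_term a (P1 x) (P2 x) (P3 x) n)); [exact Hp|].
  intros n _. unfold eval_term, sum_deg.
  apply (sum_n_pointwise_ind Pr (fun i x => sum_n (fun j =>
    (a i j (n - i - j)%nat * (P1 x ^ i * P2 x ^ j * P3 x ^ (n - i - j)))%C) (n - i)));
    [exact Hp|]. intros i _.
  apply (sum_n_pointwise_ind Pr (fun j x =>
    (a i j (n - i - j)%nat * (P1 x ^ i * P2 x ^ j * P3 x ^ (n - i - j)))%C)); [exact Hp|].
  intros j _. apply Ht.
Qed.

Lemma pow_half_small (K eps : R) :
  0 < eps -> exists N, forall n, (N <= n)%nat -> K * (1 / 2) ^ S n < eps.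
Proof.
  intro He.
  assert (HK : 0 < eps / (Rabs K + 1)).
  { apply Rdiv_lt_0_compat; [exact He|]. assert (H := Rabs_pos K). lra. }
  assert (Hh : Rabs (1 / 2) < 1) by (rewrite Rabs_pos_eq; lra).
  destruct (pow_lt_1_zero (1 / 2) Hh _ HK) as [N HN].
  exists N. intros n Hn. specialize (HN (S n) ltac:(lia)).
  assert (Hp : 0 < (1 / 2) ^ S n) by (apply pow_lt; lra).
  rewrite Rabs_pos_eq in HN by lra.
  assert (H := Rabs_pos K). assert (H' := Rle_abs K).
  apply (Rmult_lt_compat_l (Rabs K + 1)) in HN; [|lra].
  replace ((Rabs K + 1) * (eps / (Rabs K + 1))) with eps in HN by (field; lra).
  nra.
Qed.

(** The bound does not depend on the point: partial sums converge uniformly along a path. *)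
Lemma eval_approx_half (a : ps3) (P1 P2 P3 : C) (r B m : R) (N : nat) :
  0 < r -> coef_bound a r B -> m <= r / 4 ->
  Cmod P1 <= m -> Cmod P2 <= m -> Cmod P3 <= m ->
  Cmod (ps_eval a (P1, P2, P3) - sum_n (eval_term a P1 P2 P3) N) <= 16 * B * (1 / 2) ^ S N.
Proof.
  intros Hr H Hm H1 H2 H3.
  assert (Hm0 : 0 <= m) by (eapply Rle_trans; [apply Cmod_ge_0 | exact H1]).
  destruct (eval_approx a P1 P2 P3 r B m Hr H Hm H1 H2 H3) as [_ E].
  eapply Rle_trans; [apply E|]. apply Rmult_le_compat_l.
  - assert (HB := coef_bound_nonneg a r B (Rlt_le _ _ Hr) H). lra.
  - apply pow_incr. split; [apply Rdiv_le_0_compat; lra|].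
    apply Rmult_le_reg_r with r; [exact Hr|]. field_simplify; lra.
Qed.

(** A uniform limit of continuous functions; the hypotheses on a ball around t are the form that
    [CVU_continuity] asks for. *)
Lemma eval_path_continuity (a : ps3) (P1 P2 P3 : R -> C) (r B m t : R) (d : posreal) :
  0 < r -> coef_bound a r B -> m <= r / 4 ->
  (forall x, Boule t d x -> Cmod (P1 x) <= m /\ Cmod (P2 x) <= m /\ Cmod (P3 x) <= m) ->
  (forall x, Boule t d x ->
     C_continuity_pt P1 x /\ C_continuity_pt P2 x /\ C_continuity_pt P3 x) ->
  C_continuity_pt (fun x => ps_eval a (P1 x, P2 x, P3 x)) t.
Proof.
  intros Hr H Hm HP HC.
  set (S_ N x := sum_n (eval_term a (P1 x) (P2 x) (P3 x)) N).
  assert (HS : forall N x, Boule t d x -> C_continuity_pt (S_ N) x).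
  { intros N x Hx. destruct (HC x Hx) as [C1 [C2 C3]].
    apply (partial_eval_ind (fun g => C_continuity_pt g x)).
    - intros f g. apply C_continuity_pt_plus.
    - intros i j k. apply C_continuity_pt_mult; [apply C_continuity_pt_const|].
      repeat apply C_continuity_pt_mult; now apply C_continuity_pt_pow. }
  assert (HA : forall N x, Boule t d x ->
     Cmod (ps_eval a (P1 x, P2 x, P3 x) - S_ N x) <= 16 * B * (1 / 2) ^ S N).
  { intros N x Hx. destruct (HP x Hx) as [M1 [M2 M3]].
    now apply eval_approx_half with r m. }
  assert (Ht : Boule t d t).
  { unfold Boule. rewrite Rminus_diag, Rabs_R0. apply cond_pos. }
  split.
  - apply (CVU_continuity (fun N x => Re (S_ N x)) _ t d); [|intros; now apply HS | exact Ht].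
    intros eps He. destruct (pow_half_small (16 * B) eps He) as [N HN].
    exists N. intros n x Hn Hx. eapply Rle_lt_trans; [|apply (HN n Hn)].
    eapply Rle_trans; [|apply (HA n x Hx)]. exact (re_le_Cmod (_ - _)%C).
  - apply (CVU_continuity (fun N x => Im (S_ N x)) _ t d); [|intros; now apply HS | exact Ht].
    intros eps He. destruct (pow_half_small (16 * B) eps He) as [N HN].
    exists N. intros n x Hn Hx. eapply Rle_lt_trans; [|apply (HN n Hn)].
    eapply Rle_trans; [|apply (HA n x Hx)]. exact (im_le_Cmod (_ - _)%C).
Qed.

Lemma radial_product_path_continuity (nu1 nu2 nu3 : ps3) (P1 P2 P3 : R -> C)
    (r B m t : R) (d : posreal) :
  0 < r -> coef_bound nu1 r B -> coef_bound nu2 r B -> coef_bound nu3 r B -> m <= r / 4 ->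
  (forall x, Boule t d x -> Cmod (P1 x) <= m /\ Cmod (P2 x) <= m /\ Cmod (P3 x) <= m) ->
  (forall x, Boule t d x ->
     C_continuity_pt P1 x /\ C_continuity_pt P2 x /\ C_continuity_pt P3 x) ->
  continuity_pt (fun x => radial_product nu1 nu2 nu3 (P1 x, P2 x, P3 x)) t.
Proof.
  intros Hr H1 H2 H3 Hm HP HC.
  assert (Ht : Boule t d t).
  { unfold Boule. rewrite Rminus_diag, Rabs_R0. apply cond_pos. }
  destruct (HC t Ht) as [C1 [C2 C3]].
  assert (E := fun a Ha => eval_path_continuity a P1 P2 P3 r B m t d Hr Ha Hm HP HC).
  apply (continuity_pt_scal (fun x => Re (ps_eval nu1 (P1 x, P2 x, P3 x) * Cconj (P1 x)
    + ps_eval nu2 (P1 x, P2 x, P3 x) * Cconj (P2 x)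
    + ps_eval nu3 (P1 x, P2 x, P3 x) * Cconj (P3 x))%C) 2).
  refine (proj1 (C_continuity_pt_plus _ _ t (C_continuity_pt_plus _ _ t _ _) _));
    apply C_continuity_pt_mult; try (now apply E); now apply C_continuity_pt_conj.
Qed.

(** * The case [Re h(0) <> 0]: a real path *)

Lemma eval_term_0 (a : ps3) (P1 P2 P3 : C) : eval_term a P1 P2 P3 0 = a 0%nat 0%nat 0%nat.
Proof. unfold eval_term, sum_deg. rewrite !sum_O. cbn [Nat.sub Cpow]. ring. Qed.

Lemma eval_term_1 (a : ps3) (P1 P2 P3 : C) : eval_term a P1 P2 P3 1 =
  (a 1%nat 0%nat 0%nat * P1 + a 0%nat 1%nat 0%nat * P2 + a 0%nat 0%nat 1%nat * P3)%C.
Proof.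
  unfold eval_term, sum_deg. rewrite sum_Sn, sum_O. cbn [Nat.sub].
  rewrite sum_Sn, !sum_O. cbn [Nat.sub Cpow].
  change plus with Cplus. ring.
Qed.

Lemma eval_first_order (a : ps3) (P1 P2 P3 : C) (r B m : R) :
  0 < r -> coef_bound a r B -> m <= r / 4 ->
  Cmod P1 <= m -> Cmod P2 <= m -> Cmod P3 <= m -> a 0%nat 0%nat 0%nat = RtoC 0 ->
  Cmod (ps_eval a (P1, P2, P3)) <= 32 * B / r * m /\
  Cmod (ps_eval a (P1, P2, P3) - (a 1%nat 0%nat 0%nat * P1 + a 0%nat 1%nat 0%nat * P2
          + a 0%nat 0%nat 1%nat * P3)) <= 64 * B / r ^ 2 * m ^ 2.
Proof.
  intros Hr H Hm H1 H2 H3 H0.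
  destruct (eval_approx a P1 P2 P3 r B m Hr H Hm H1 H2 H3) as [_ E].
  assert (E0 := E 0%nat). assert (E1 := E 1%nat).
  rewrite sum_Sn in E1. rewrite sum_O, eval_term_0, H0 in E0, E1. rewrite eval_term_1 in E1.
  split.
  - replace (32 * B / r * m) with (16 * B * (2 * m / r) ^ 1) by (field; lra).
    replace (ps_eval a (P1, P2, P3)) with (ps_eval a (P1, P2, P3) - RtoC 0)%C by ring.
    exact E0.
  - replace (64 * B / r ^ 2 * m ^ 2) with (16 * B * (2 * m / r) ^ 2) by (field; lra).
    change plus with Cplus in E1. rewrite Cplus_0_l in E1. exact E1.
Qed.

(** With w = rho^2 and v = t w the equation becomes x1^2 = rho^6 (- t^3 - rho^6). For t < 0 and
    small rho this has a real solution x1 of order rho^3, negligible against w. Taking rho as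
    parameter avoids half-integer powers. *)
Definition real_path1 (rho t : R) : C := RtoC (rho ^ 3 * sqrt (- t ^ 3 - rho ^ 6)).
Definition real_path2 (rho t : R) : C := RtoC ((t + 3) * rho ^ 2).
Definition real_path3 (rho t : R) : C := RtoC (rho ^ 2).

(** The interval is [-9/4, -1], on which the intermediate value theorem is used, enlarged by 1/8 on
    either side to hold the balls in the continuity argument. *)
Lemma real_path_bounds (rho t : R) :
  0 < rho <= 1 / 2 -> -19 / 8 <= t <= -7 / 8 ->
  0 <= - t ^ 3 - rho ^ 6 /\
  Cmod (real_path1 rho t) <= 4 * rho ^ 3 /\ Cmod (real_path1 rho t) <= 3 * rho ^ 2 /\
  Cmod (real_path2 rho t) <= 3 * rho ^ 2 /\ Cmod (real_path3 rho t) <= 3 * rho ^ 2.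
Proof.
  intros Hrho Ht.
  assert (Hr2 : 0 < rho ^ 2 <= 1 / 4) by (simpl; nra).
  assert (Hr6 : 0 < rho ^ 6 <= 1 / 64).
  { replace (rho ^ 6) with ((rho ^ 2) ^ 3) by ring. split; [apply pow_lt; lra|].
    replace (1 / 64) with ((1 / 4) ^ 3) by field. apply pow_incr; lra. }
  assert (Ht3 : 1 / 64 <= - t ^ 3 <= 16).
  { replace (- t ^ 3) with ((- t) ^ 3) by ring. split.
    - apply Rle_trans with ((7 / 8) ^ 3); [lra | apply pow_incr; lra].
    - apply Rle_trans with ((19 / 8) ^ 3); [apply pow_incr; lra | lra]. }
  assert (Hs : 0 <= sqrt (- t ^ 3 - rho ^ 6) <= 4).
  { split; [apply sqrt_pos|]. replace 4 with (sqrt (4 * 4)) by (apply sqrt_square; lra).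
    apply sqrt_le_1_alt. lra. }
  assert (Hr3 : 0 < rho ^ 3) by (apply pow_lt; lra).
  assert (H1 : Cmod (real_path1 rho t) <= 4 * rho ^ 3).
  { unfold real_path1. rewrite Cmod_R, Rabs_pos_eq by nra. nra. }
  split; [lra|]. split; [exact H1|]. split; [|split].
  - apply Rle_trans with (4 * rho ^ 3); [exact H1|].
    replace (rho ^ 3) with (rho * rho ^ 2) by ring. nra.
  - unfold real_path2. rewrite Cmod_R, Rabs_pos_eq by nra. nra.
  - unfold real_path3. rewrite Cmod_R, Rabs_pos_eq by lra. lra.
Qed.

Lemma real_path_hypersurface (rho t : R) :
  0 <= - t ^ 3 - rho ^ 6 ->
  hypersurface fD (real_path1 rho t, real_path2 rho t, real_path3 rho t).
Proof.
  intro H. unfold hypersurface. rewrite (has_eval_eq _ _ _ _ _ (has_eval_fD _ _ _)).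
  unfold real_path1, real_path2, real_path3.
  rewrite <- !RtoC_mult, <- RtoC_minus, <- !RtoC_pow, <- !RtoC_plus. f_equal.
  rewrite (Rpow_mult_distr (rho ^ 3)), pow2_sqrt by exact H. ring.
Qed.

Lemma real_path_continuity (rho t : R) :
  0 < - t ^ 3 - rho ^ 6 ->
  C_continuity_pt (real_path1 rho) t /\ C_continuity_pt (real_path2 rho) t /\
  C_continuity_pt (real_path3 rho) t.
Proof.
  intro H. repeat split; try (now apply continuity_pt_const).
  - change (continuity_pt (fun x => rho ^ 3 * sqrt (- x ^ 3 - rho ^ 6)) t).
    apply (continuity_pt_scal (fun x => sqrt (- x ^ 3 - rho ^ 6)) (rho ^ 3)).
    apply (continuity_pt_comp (fun x => - x ^ 3 - rho ^ 6) sqrt).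
    + apply derivable_continuous_pt. reg.
    + apply continuity_pt_sqrt. lra.
  - change (continuity_pt (fun x => (x + 3) * rho ^ 2) t).
    apply derivable_continuous_pt. reg.
Qed.

Lemma norm_sq_bound (P1 P2 P3 : C) (m : R) :
  Cmod P1 <= m -> Cmod P2 <= m -> Cmod P3 <= m -> norm_sq (P1, P2, P3) <= 3 * m ^ 2.
Proof.
  intros H1 H2 H3. unfold norm_sq.
  assert (E : forall z, Cmod z <= m -> Cmod z ^ 2 <= m ^ 2).
  { intros z Hz. apply pow_incr. split; [apply Cmod_ge_0 | exact Hz]. }
  assert (E1 := E _ H1). assert (E2 := E _ H2). assert (E3 := E _ H3). lra.
Qed.

Lemma norm_sq_pos (P1 P2 P3 : C) : P3 <> RtoC 0 -> 0 < norm_sq (P1, P2, P3).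
Proof.
  intro H. unfold norm_sq. apply Cmod_gt_0 in H.
  assert (0 < Cmod P3 ^ 2) by (apply pow_lt; lra).
  assert (0 <= Cmod P1 ^ 2) by (apply pow_le, Cmod_ge_0).
  assert (0 <= Cmod P2 ^ 2) by (apply pow_le, Cmod_ge_0). lra.
Qed.

(** The points are real, so conjugation disappears. Terms containing x1 have size rho^3 rho^2 and
    the second-order remainders have size rho^4 rho^2, against a main term of order rho^4. *)
Lemma radial_product_real_path (nu1 nu2 nu3 : ps3) (l : C) (r B rho t : R) :
  0 < r -> coef_bound nu1 r B -> coef_bound nu2 r B -> coef_bound nu3 r B ->
  nu1 0%nat 0%nat 0%nat = RtoC 0 -> nu2 0%nat 0%nat 0%nat = RtoC 0 ->
  nu3 0%nat 0%nat 0%nat = RtoC 0 ->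
  nu2 0%nat 1%nat 0%nat = (RtoC (/ 3) * l)%C ->
  nu2 0%nat 0%nat 1%nat = (RtoC (- / 2) * l)%C ->
  nu3 0%nat 1%nat 0%nat = RtoC 0 ->
  nu3 0%nat 0%nat 1%nat = (RtoC (/ 6) * l)%C ->
  0 < rho <= 1 / 2 -> 3 * rho ^ 2 <= r / 4 -> -19 / 8 <= t <= -7 / 8 ->
  Rabs (radial_product nu1 nu2 nu3 (real_path1 rho t, real_path2 rho t, real_path3 rho t)
        - Re l / 3 * (2 * t ^ 2 + 9 * t + 10) * rho ^ 4)
  <= 2 * (12 * (32 * B / r) + 12 * Cmod (nu2 1%nat 0%nat 0%nat)
          + 12 * Cmod (nu3 1%nat 0%nat 0%nat) + 54 * (64 * B / r ^ 2)) * rho ^ 5.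
Proof.
  intros Hr B1 B2 B3 V1 V2 V3 L21 L22 L31 L32 Hrho Hsmall Ht.
  assert (HB := coef_bound_nonneg nu1 r B (Rlt_le _ _ Hr) B1).
  destruct (real_path_bounds rho t Hrho Ht) as [Hp [M1 [M1' [M2 M3]]]].
  set (P1 := real_path1 rho t) in *. set (P2 := real_path2 rho t) in *.
  set (P3 := real_path3 rho t) in *.
  destruct (eval_first_order nu1 P1 P2 P3 r B _ Hr B1 Hsmall M1' M2 M3 V1) as [E1 _].
  destruct (eval_first_order nu2 P1 P2 P3 r B _ Hr B2 Hsmall M1' M2 M3 V2) as [_ E2].
  destruct (eval_first_order nu3 P1 P2 P3 r B _ Hr B3 Hsmall M1' M2 M3 V3) as [_ E3].
  rewrite L21, L22 in E2. rewrite L31, L32 in E3.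
  set (n1 := ps_eval nu1 (P1, P2, P3)) in *.
  set (n2 := ps_eval nu2 (P1, P2, P3)) in *.
  set (n3 := ps_eval nu3 (P1, P2, P3)) in *.
  set (c2 := nu2 1%nat 0%nat 0%nat) in *. set (c3 := nu3 1%nat 0%nat 0%nat) in *.
  set (K1 := 32 * B / r) in *. set (K2 := 64 * B / r ^ 2) in *.
  assert (HK1 : 0 <= K1) by (apply Rdiv_le_0_compat; lra).
  assert (HK2 : 0 <= K2) by (apply Rdiv_le_0_compat; [lra | apply pow_lt; lra]).
  set (e2 := (n2 - (c2 * P1 + RtoC (/ 3) * l * P2 + RtoC (- / 2) * l * P3))%C) in *.
  set (e3 := (n3 - (c3 * P1 + RtoC 0 * P2 + RtoC (/ 6) * l * P3))%C) in *.
  set (err := (n1 * P1 + (c2 * P1 + e2) * P2 + (c3 * P1 + e3) * P3)%C).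
  assert (Hmain : radial_product nu1 nu2 nu3 (P1, P2, P3) =
            2 * Re (RtoC ((2 * t ^ 2 + 9 * t + 10) * rho ^ 4 / 6) * l + err)%C).
  { unfold radial_product. fold n1 n2 n3. f_equal. f_equal.
    replace (Cconj P1) with P1 by (unfold P1, real_path1, Cconj, RtoC; simpl; f_equal; ring).
    replace (Cconj P2) with P2 by (unfold P2, real_path2, Cconj, RtoC; simpl; f_equal; ring).
    replace (Cconj P3) with P3 by (unfold P3, real_path3, Cconj, RtoC; simpl; f_equal; ring).
    unfold err, e2, e3.
    replace (RtoC ((2 * t ^ 2 + 9 * t + 10) * rho ^ 4 / 6))
      with (RtoC (/ 3) * P2 * P2 + RtoC (- / 2) * P3 * P2 + RtoC (/ 6) * P3 * P3)%C.
    - ring.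
    - unfold P2, P3, real_path2, real_path3. rewrite <- !RtoC_mult, <- !RtoC_plus.
      f_equal. field. }
  rewrite Hmain, (re_plus : forall x y, Re (x + y)%C = Re x + Re y).
  replace (Re (RtoC _ * l)%C) with ((2 * t ^ 2 + 9 * t + 10) * rho ^ 4 / 6 * Re l)
    by (simpl; unfold Re; ring).
  replace (2 * _ - _) with (2 * Re err) by field.
  rewrite Rabs_mult, (Rabs_pos_eq 2) by lra. rewrite !Rmult_assoc.
  apply Rmult_le_compat_l; [lra|].
  eapply Rle_trans; [apply re_le_Cmod|]. unfold err.
  assert (T := fun x y X Y (Hx : Cmod x <= X) (Hy : Cmod y <= Y) =>
    Rmult_le_compat _ _ _ _ (Cmod_ge_0 x) (Cmod_ge_0 y) Hx Hy).
  assert (A := fun x y X Y (Hx : Cmod x <= X) (Hy : Cmod y <= Y) =>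
    Rle_trans _ _ _ (Cmod_triangle x y) (Rplus_le_compat _ _ _ _ Hx Hy)).
  assert (HM : forall x y X Y, Cmod x <= X -> Cmod y <= Y -> Cmod (x * y)%C <= X * Y).
  { intros. rewrite Cmod_mult. now apply T. }
  eapply Rle_trans.
  { apply A; [apply A|]; apply HM; [exact E1 | exact M1 | | exact M2 | | exact M3];
      (apply A; [apply HM; [apply Rle_refl | exact M1] | eassumption]). }
  assert (Hr5 : 0 < rho ^ 5) by (apply pow_lt; lra).
  assert (Hr6 : 54 * K2 * rho ^ 6 <= 54 * K2 * rho ^ 5).
  { apply Rmult_le_compat_l; [lra|]. replace (rho ^ 6) with (rho * rho ^ 5) by ring. nra. }
  match goal with |- ?x <= _ =>
    replace x with ((12 * K1 + 12 * Cmod c2 + 12 * Cmod c3) * rho ^ 5 + 54 * K2 * rho ^ 6)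
      by ring end.
  lra.
Qed.

(** The quadratic form [2 t^2 + 9 t + 10] is negative at [t = -9/4] and positive
    at [t = -1]. *)
Lemma radial_product_zero_real_path (nu1 nu2 nu3 : ps3) (l : C) (r B eps0 : R) :
  0 < r -> coef_bound nu1 r B -> coef_bound nu2 r B -> coef_bound nu3 r B ->
  nu1 0%nat 0%nat 0%nat = RtoC 0 -> nu2 0%nat 0%nat 0%nat = RtoC 0 ->
  nu3 0%nat 0%nat 0%nat = RtoC 0 ->
  nu2 0%nat 1%nat 0%nat = (RtoC (/ 3) * l)%C ->
  nu2 0%nat 0%nat 1%nat = (RtoC (- / 2) * l)%C ->
  nu3 0%nat 1%nat 0%nat = RtoC 0 ->
  nu3 0%nat 0%nat 1%nat = (RtoC (/ 6) * l)%C ->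
  Re l <> 0 -> 0 < eps0 ->
  exists P, hypersurface fD P /\ 0 < norm_sq P < eps0 ^ 2 /\
    radial_product nu1 nu2 nu3 P = 0.
Proof.
  intros Hr B1 B2 B3 V1 V2 V3 L21 L22 L31 L32 Hl He.
  set (M := 2 * (12 * (32 * B / r) + 12 * Cmod (nu2 1%nat 0%nat 0%nat)
          + 12 * Cmod (nu3 1%nat 0%nat 0%nat) + 54 * (64 * B / r ^ 2))).
  assert (HB := coef_bound_nonneg nu1 r B (Rlt_le _ _ Hr) B1).
  assert (HM : 0 <= M).
  { assert (0 <= 32 * B / r) by (apply Rdiv_le_0_compat; lra).
    assert (0 <= 64 * B / r ^ 2) by (apply Rdiv_le_0_compat; [lra | apply pow_lt; lra]).
    assert (H1 := Cmod_ge_0 (nu2 1%nat 0%nat 0%nat)).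
    assert (H2 := Cmod_ge_0 (nu3 1%nat 0%nat 0%nat)). unfold M. lra. }
  assert (Hal : 0 < Rabs (Re l)) by now apply Rabs_pos_lt.
  (* The bounds 1/2 and r/6 give 3 rho^2 <= r/4, and eps0/6 controls the norm. The last one makes
     the error M rho^5 smaller than |Re l| rho^4 / 24, the size of the main term at t = -9/4; at t =
     -1 the main term is larger. *)
  set (rho := Rmin (Rmin (1 / 2) (r / 6)) (Rmin (eps0 / 6) (Rabs (Re l) / (25 * (M + 1))))).
  assert (Hrho : 0 < rho /\ rho <= 1 / 2 /\ rho <= r / 6 /\ rho <= eps0 / 6 /\
                 rho <= Rabs (Re l) / (25 * (M + 1))).
  { assert (0 < Rabs (Re l) / (25 * (M + 1))) by (apply Rdiv_lt_0_compat; lra).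
    assert (m1 := Rmin_l (Rmin (1 / 2) (r / 6)) (Rmin (eps0 / 6) (Rabs (Re l) / (25 * (M + 1))))).
    assert (m2 := Rmin_r (Rmin (1 / 2) (r / 6)) (Rmin (eps0 / 6) (Rabs (Re l) / (25 * (M + 1))))).
    assert (m3 := Rmin_l (1 / 2) (r / 6)). assert (m4 := Rmin_r (1 / 2) (r / 6)).
    assert (m5 := Rmin_l (eps0 / 6) (Rabs (Re l) / (25 * (M + 1)))).
    assert (m6 := Rmin_r (eps0 / 6) (Rabs (Re l) / (25 * (M + 1)))).
    fold rho in m1, m2. repeat split; try lra.
    unfold rho. repeat apply Rmin_glb_lt; lra. }
  destruct Hrho as [Hrho0 [Hrho1 [Hrho2 [Hrho3 Hrho4]]]].
  assert (Hsmall : 3 * rho ^ 2 <= r / 4) by (simpl; nra).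
  assert (HMrho : M * rho < Rabs (Re l) / 24).
  { apply (Rmult_le_compat_l (M + 1)) in Hrho4; [|lra].
    replace ((M + 1) * (Rabs (Re l) / (25 * (M + 1)))) with (Rabs (Re l) / 25) in Hrho4
      by (field; lra). lra. }
  assert (Hrho4p : 0 < rho ^ 4) by (apply pow_lt; lra).
  set (F := fun t => radial_product nu1 nu2 nu3
              (real_path1 rho t, real_path2 rho t, real_path3 rho t)).
  assert (HF : forall t, -19 / 8 <= t <= -7 / 8 ->
     Rabs (F t - Re l / 3 * (2 * t ^ 2 + 9 * t + 10) * rho ^ 4) < Rabs (Re l) / 24 * rho ^ 4).
  { intros t Ht. eapply Rle_lt_trans.
    - apply (radial_product_real_path nu1 nu2 nu3 l r B rho t); try assumption. lra.
    - fold M. replace (M * rho ^ 5) with (M * rho * rho ^ 4) by ring.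
      now apply Rmult_lt_compat_r. }
  (* -9/4 is the midpoint of the roots -5/2 and -2 of 2 t^2 + 9 t + 10. *)
  assert (H1 := HF (-9 / 4) ltac:(lra)). assert (H2 := HF (-1) ltac:(lra)).
  replace (2 * (-9 / 4) ^ 2 + 9 * (-9 / 4) + 10) with (-1 / 8) in H1 by field.
  replace (2 * (-1) ^ 2 + 9 * (-1) + 10) with 3 in H2 by ring.
  assert (Hcont : forall t, -9 / 4 <= t <= -1 -> continuity_pt F t).
  { intros t Ht. assert (Hd : 0 < 1 / 8) by lra.
    assert (HBoule : forall x, Boule t (mkposreal _ Hd) x -> -19 / 8 <= x <= -7 / 8).
    { intros x Hx. unfold Boule in Hx. simpl in Hx. apply Rabs_def2 in Hx. lra. }
    apply (radial_product_path_continuity nu1 nu2 nu3 (real_path1 rho) (real_path2 rho)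
             (real_path3 rho) r B (3 * rho ^ 2) t (mkposreal _ Hd)); try assumption.
    - intros x Hx. now destruct (real_path_bounds rho x (conj Hrho0 Hrho1) (HBoule x Hx))
        as [_ [_ H]].
    - intros x Hx. apply real_path_continuity. apply HBoule in Hx.
      assert (0 < rho ^ 6) by (apply pow_lt; lra).
      assert (rho ^ 6 <= (1 / 2) ^ 6) by (apply pow_incr; lra).
      assert ((7 / 8) ^ 3 <= (- x) ^ 3) by (apply pow_incr; lra).
      replace (- x ^ 3) with ((- x) ^ 3) by ring. lra. }
  assert (Hz : exists t, -9 / 4 <= t <= -1 /\ F t = 0).
  { apply Rabs_def2 in H1. apply Rabs_def2 in H2.
    destruct (Rlt_or_le 0 (Re l)) as [Hpos|Hneg].
    - rewrite (Rabs_pos_eq (Re l)) in H1, H2 by lra.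
      assert (0 < Re l * rho ^ 4) by now apply Rmult_lt_0_compat.
      destruct (IVT_interv F (-9 / 4) (-1)) as [t [Ht HFt]]; [exact Hcont | lra.. |].
      now exists t.
    - assert (Hneg' : Re l < 0) by lra. rewrite (Rabs_left (Re l)) in H1, H2 by lra.
      assert (0 < - Re l * rho ^ 4) by (apply Rmult_lt_0_compat; lra).
      destruct (IVT_interv (fun t => - F t) (-9 / 4) (-1)) as [t [Ht HFt]]; [|lra..|].
      + intros t Ht. now apply continuity_pt_opp, Hcont.
      + exists t. split; [exact Ht | lra]. }
  destruct Hz as [t [Ht HFt]].
  destruct (real_path_bounds rho t (conj Hrho0 Hrho1) ltac:(lra)) as [Hp [_ [M1 [M2 M3]]]].
  exists (real_path1 rho t, real_path2 rho t, real_path3 rho t).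
  split; [now apply real_path_hypersurface|]. split; [split|exact HFt].
  - apply norm_sq_pos, RtoC_neq_0. apply pow_nonzero. lra.
  - eapply Rle_lt_trans; [apply (norm_sq_bound _ _ _ _ M1 M2 M3)|].
    apply Rle_lt_trans with (27 / 4 * rho ^ 2).
    + replace (3 * (3 * rho ^ 2) ^ 2) with (27 * (rho ^ 2 * rho ^ 2)) by ring.
      assert (0 <= rho ^ 2 <= 1 / 4) by (simpl; nra). nra.
    + apply Rle_lt_trans with (27 / 4 * (eps0 / 6) ^ 2).
      * apply Rmult_le_compat_l; [lra|]. apply pow_incr; lra.
      * assert (0 < eps0 ^ 2) by (apply pow_lt; lra). simpl in *. nra.
Qed.

(** * The case [Re h(0) = 0]: mean values on a circle *)

Definition circle (rho th : R) : C := (rho * cos th, rho * sin th).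

Lemma circle_pow (rho th : R) (n : nat) :
  (circle rho th ^ n)%C = (rho ^ n * cos (INR n * th), rho ^ n * sin (INR n * th)).
Proof.
  induction n as [|n IH].
  - cbn [Cpow pow]. rewrite Rmult_0_l, cos_0, sin_0. unfold RtoC. f_equal; ring.
  - cbn [Cpow]. rewrite IH, S_INR.
    replace ((INR n + 1) * th) with (th + INR n * th) by ring.
    rewrite cos_plus, sin_plus. unfold circle, Cmult. simpl. f_equal; ring.
Qed.

Lemma circle_conj_pow (rho th : R) (n : nat) :
  (Cconj (circle rho th) ^ n)%C = (rho ^ n * cos (INR n * th), - (rho ^ n * sin (INR n * th))).
Proof. rewrite <- Cpow_conj, circle_pow. reflexivity. Qed.

Lemma Cmod_circle (rho th : R) : 0 <= rho -> Cmod (circle rho th) = rho.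
Proof.
  intro H. unfold Cmod, circle. cbn [fst snd].
  replace ((rho * cos th) ^ 2 + (rho * sin th) ^ 2) with (rho ^ 2).
  - now apply sqrt_pow2.
  - assert (E := sin2_cos2 th). unfold Rsqr in E.
    replace (rho ^ 2) with (rho ^ 2 * 1) by ring. rewrite <- E. ring.
Qed.

Lemma circle_mul_conj (rho th : R) :
  (circle rho th * Cconj (circle rho th))%C = RtoC (rho ^ 2).
Proof.
  unfold circle, Cconj, Cmult, RtoC. cbn [fst snd]. f_equal; [|ring].
  assert (E := sin2_cos2 th). unfold Rsqr in E.
  replace (rho ^ 2) with (rho ^ 2 * 1) by ring. rewrite <- E. ring.
Qed.

Lemma cos_sin_full_turns (p m : nat) :
  cos ((INR p - INR m) * (2 * PI)) = 1 /\ sin ((INR p - INR m) * (2 * PI)) = 0.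
Proof.
  replace ((INR p - INR m) * (2 * PI)) with (0 + 2 * INR p * PI - (0 + 2 * INR m * PI)) by ring.
  rewrite cos_minus, sin_minus, !cos_period, !sin_period, cos_0, sin_0. split; ring.
Qed.

Lemma is_RInt_trig (A B : R) (p m : nat) :
  p <> m ->
  is_RInt (fun th => A * cos ((INR p - INR m) * th) - B * sin ((INR p - INR m) * th))
    0 (2 * PI) 0.
Proof.
  intro H. assert (Hn : INR p - INR m <> 0).
  { intro E. apply H, INR_eq. lra. }
  destruct (cos_sin_full_turns p m) as [Hc Hs].
  set (n := INR p - INR m) in *.
  set (G := fun th => A * sin (n * th) / n + B * cos (n * th) / n).
  replace 0 with (minus (G (2 * PI)) (G 0)) at 2.
  - apply (is_RInt_derive G).
    + intros x _. unfold G. auto_derive; [exact I | field; exact Hn].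
    + intros x _. apply (ex_derive_continuous (V := R_NormedModule)). auto_derive. exact I.
  - unfold G. rewrite Hc, Hs, (Rmult_0_r n), cos_0, sin_0.
    unfold minus, plus, opp; simpl. lra.
Qed.

(** Only the real part is integrated, as the radial product is itself a real part. *)
Definition zero_mean (g : R -> C) : Prop := is_RInt (fun th => Re (g th)) 0 (2 * PI) 0.

Lemma zero_mean_plus (f g : R -> C) :
  zero_mean f -> zero_mean g -> zero_mean (fun th => (f th + g th)%C).
Proof.
  intros Hf Hg. unfold zero_mean. replace 0 with (plus 0 0) at 2 by apply Rplus_0_l.
  exact (is_RInt_plus _ _ _ _ _ _ Hf Hg).
Qed.

(** Orthogonality of the exponentials: s^p conj(s)^m has the nonzero frequency p - m. *)
Lemma zero_mean_circle (c : C) (rho : R) (p m : nat) :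
  p <> m -> zero_mean (fun th => (c * (circle rho th ^ p * Cconj (circle rho th) ^ m))%C).
Proof.
  intro H. unfold zero_mean.
  apply (is_RInt_ext (fun th => Re c * rho ^ p * rho ^ m * cos ((INR p - INR m) * th)
                              - Im c * rho ^ p * rho ^ m * sin ((INR p - INR m) * th))).
  - intros th _. rewrite circle_pow, circle_conj_pow, Rmult_minus_distr_r, cos_minus, sin_minus.
    simpl. unfold Re, Im. ring.
  - now apply is_RInt_trig.
Qed.

Lemma zero_mean_0 (c : R -> C) : (forall th, c th = RtoC 0) -> zero_mean c.
Proof.
  intro H. unfold zero_mean. apply (is_RInt_ext (fun _ => 0)).
  - intros th _. now rewrite H.
  - assert (E := is_RInt_const (V := R_NormedModule) 0 (2 * PI) 0).
    change (scal (2 * PI - 0) 0) with ((2 * PI - 0) * 0) in E. now rewrite Rmult_0_r in E.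
Qed.

(** The curve [s -> (i s^3, 3 s, s)], on which [x2 - 3 x3 = 0], lies in [{f = 0}]. *)
Definition curve1 (rho th : R) : C := (Ci * circle rho th ^ 3)%C.
Definition curve2 (rho th : R) : C := (RtoC 3 * circle rho th)%C.
Definition curve3 (rho th : R) : C := circle rho th.

Lemma Ci_sqr : (Ci * Ci)%C = (- RtoC 1)%C.
Proof. unfold Ci, Cmult, Copp, RtoC. simpl. f_equal; ring. Qed.

Lemma curve_hypersurface (rho th : R) :
  hypersurface fD (curve1 rho th, curve2 rho th, curve3 rho th).
Proof.
  unfold hypersurface. rewrite (has_eval_eq _ _ _ _ _ (has_eval_fD _ _ _)).
  unfold curve1, curve2, curve3. set (s := circle rho th).
  replace ((Ci * s ^ 3) ^ 2)%C with (Ci * Ci * s ^ 6)%C by ring.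
  rewrite Ci_sqr. ring.
Qed.

Lemma curve_bounds (rho th : R) :
  0 < rho <= 1 ->
  Cmod (curve1 rho th) <= 3 * rho /\ Cmod (curve2 rho th) <= 3 * rho /\
  Cmod (curve3 rho th) <= 3 * rho.
Proof.
  intro H. unfold curve1, curve2, curve3.
  rewrite !Cmod_mult, Cmod_pow, Cmod_circle, Cmod_Ci, Cmod_R, Rabs_pos_eq by lra.
  split; [|lra]. assert (rho ^ 2 <= 1 ^ 2) by (apply pow_incr; lra).
  replace (rho ^ 3) with (rho ^ 2 * rho) by ring. nra.
Qed.

Lemma curve_continuity (rho th : R) :
  C_continuity_pt (curve1 rho) th /\ C_continuity_pt (curve2 rho) th /\
  C_continuity_pt (curve3 rho) th.
Proof.
  assert (H : C_continuity_pt (circle rho) th).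
  { split.
    - change (continuity_pt (fun th => rho * cos th) th).
      apply derivable_continuous_pt. reg.
    - change (continuity_pt (fun th => rho * sin th) th).
      apply derivable_continuous_pt. reg. }
  repeat split; try apply H.
  - apply (C_continuity_pt_mult (fun _ => Ci)); [apply C_continuity_pt_const|].
    now apply C_continuity_pt_pow.
  - apply (C_continuity_pt_mult (fun _ => Ci)); [apply C_continuity_pt_const|].
    now apply C_continuity_pt_pow.
  - apply (C_continuity_pt_mult (fun _ => RtoC 3)); [apply C_continuity_pt_const | exact H].
  - apply (C_continuity_pt_mult (fun _ => RtoC 3)); [apply C_continuity_pt_const | exact H].
Qed.

(** Restricted to the curve, the monomial [x1^i x2^j x3^k] is a multiple of
    [s^(3i+j+k)]. *)
Lemma zero_mean_eval_curve (a : ps3) (c : C) (r B rho : R) (m : nat) :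
  0 < r -> coef_bound a r B -> 0 < rho <= 1 -> 3 * rho <= r / 4 ->
  (forall i j k, (3 * i + j + k = m)%nat -> a i j k = RtoC 0) ->
  zero_mean (fun th => (ps_eval a (curve1 rho th, curve2 rho th, curve3 rho th)
                        * (c * Cconj (circle rho th) ^ m))%C).
Proof.
  intros Hr H Hrho Hsmall Ha.
  set (w := fun th => (c * Cconj (circle rho th) ^ m)%C).
  set (S_ := fun (N : nat) (th : R) =>
    sum_n (eval_term a (curve1 rho th) (curve2 rho th) (curve3 rho th)) N).
  set (g := fun th => Re (ps_eval a (curve1 rho th, curve2 rho th, curve3 rho th) * w th)%C).
  assert (HS : forall N, is_RInt (fun th => Re (S_ N th * w th)%C) 0 (2 * PI) 0).
  { intro N. refine (partial_eval_ind (fun u => zero_mean (fun th => (u th * w th)%C))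
      a (curve1 rho) (curve2 rho) (curve3 rho) N _ _).
    - intros u v Hu Hv. unfold zero_mean.
      apply (is_RInt_ext (fun th => Re (u th * w th + v th * w th)%C)).
      + intros th _. now rewrite Cmult_plus_distr_r.
      + now apply zero_mean_plus.
    - intros i j k. destruct (Nat.eq_dec (3 * i + j + k) m) as [E|E].
      + rewrite (Ha i j k E). apply zero_mean_0. intro th. ring.
      + apply (is_RInt_ext (fun th => Re ((a i j k * Ci ^ i * RtoC 3 ^ j * c) *
          (circle rho th ^ (3 * i + j + k) * Cconj (circle rho th) ^ m))%C)).
        * intros th _. f_equal. unfold curve1, curve2, curve3, w.
          rewrite !Cpow_mult_l, !Cpow_add_r, Cpow_mult_r. ring.
        * now apply zero_mean_circle. }
  set (K := 16 * B * (Cmod c * rho ^ m)).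
  assert (HA : forall N th, Rabs (Re (S_ N th * w th)%C - g th) <= K * (1 / 2) ^ S N).
  { intros N th. destruct (curve_bounds rho th Hrho) as [M1 [M2 M3]].
    assert (E := eval_approx_half a _ _ _ r B _ N Hr H Hsmall M1 M2 M3).
    fold (S_ N th) in E.
    unfold g. rewrite Rabs_minus_sym.
    eapply Rle_trans; [apply (re_le_Cmod
      (ps_eval a (curve1 rho th, curve2 rho th, curve3 rho th) * w th - S_ N th * w th)%C)|].
    replace (_ - S_ N th * w th)%C
      with ((ps_eval a (curve1 rho th, curve2 rho th, curve3 rho th) - S_ N th) * w th)%C by ring.
    rewrite Cmod_mult. unfold w at 1.
    rewrite Cmod_mult, Cmod_pow, Cmod_conj, Cmod_circle by lra.
    replace (K * (1 / 2) ^ S N) with (16 * B * (1 / 2) ^ S N * (Cmod c * rho ^ m))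
      by (unfold K; ring).
    apply Rmult_le_compat_r; [|exact E].
    apply Rmult_le_pos; [apply Cmod_ge_0 | apply pow_le; lra]. }
  (* The partial sums have mean zero and converge uniformly in th, so the integral passes to the
     limit. *)
  destruct (filterlim_RInt (fun N th => Re (S_ N th * w th)%C) 0 (2 * PI) eventually
              _ g (fun _ => 0) HS) as [If [L1 L2]].
  - apply filterlim_locally. intro eps.
    destruct (pow_half_small K eps (cond_pos eps)) as [N HN].
    exists N. intros n Hn th. eapply Rle_lt_trans; [apply (HA n th) | now apply HN].
  - assert (If = 0) as ->; [|exact L2].
    exact (filterlim_locally_unique _ _ _ L1 (filterlim_const 0)).
Qed.

(** A continuous F without zeros keeps the sign of F 0, so F 0 * F would have a positive integral.
    Multiplying by F 0 treats both signs at once. *)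
Lemma is_RInt_zero_has_zero (F : R -> R) :
  (forall t, continuity_pt F t) -> is_RInt F 0 (2 * PI) 0 -> exists t, F t = 0.
Proof.
  intros HC HI. apply NNPP. intro HF.
  assert (H0 : F 0 <> 0) by (intro E; apply HF; now exists 0).
  set (G := fun t => F 0 * F t).
  assert (HG : forall t, continuity_pt G t) by (intro t; now apply continuity_pt_scal).
  assert (G0 : 0 < G 0) by (unfold G; nra).
  assert (GI : is_RInt G 0 (2 * PI) 0).
  { replace 0 with (scal (F 0) 0) at 2 by apply Rmult_0_r.
    exact (is_RInt_scal F 0 (2 * PI) (F 0) 0 HI). }
  assert (Gp : forall t, 0 < t < 2 * PI -> 0 < G t).
  { intros t Ht. destruct (Rtotal_order (G t) 0) as [E|[E|E]]; [| |exact E]; exfalso.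
    - destruct (IVT_interv (fun x => - G x) 0 t) as [z [_ Hz]]; try lra.
      + intros x _. now apply continuity_pt_opp.
      + apply HF. exists z. unfold G in Hz. apply (Rmult_eq_reg_l (F 0)); lra.
    - apply HF. exists t. apply (Rmult_eq_reg_l (F 0)); [unfold G in E; lra | exact H0]. }
  assert (HPI := PI_RGT_0).
  assert (X := RInt_gt_0 G 0 (2 * PI) ltac:(lra) Gp
    (fun x _ => proj1 (continuity_pt_filterlim G x) (HG x))).
  rewrite (is_RInt_unique G 0 (2 * PI) 0 GI) in X. lra.
Qed.

Lemma has_eval_sub (a b : ps3) (P1 P2 P3 y z : C) :
  has_eval a P1 P2 P3 y -> has_eval b P1 P2 P3 z -> has_eval (ps_sub a b) P1 P2 P3 (y - z)%C.
Proof.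
  intros Ha Hb. rewrite ps_sub_scal.
  replace (y - z)%C with (y + RtoC (-1) * z)%C.
  - now apply has_eval_add, has_eval_scal.
  - replace (RtoC (-1)) with (- RtoC 1)%C by (rewrite <- RtoC_opp; f_equal; lra). ring.
Qed.

(** The terms of [a] which restrict to multiples of [s] and of [s^3] on the curve. *)
Definition curve_part1 (a : ps3) : ps3 :=
  (a 0%nat 1%nat 0%nat *: ps_monomial 0 1 0 + a 0%nat 0%nat 1%nat *: ps_monomial 0 0 1)%ps.

Definition curve_part3 (a : ps3) : ps3 :=
  (a 1%nat 0%nat 0%nat *: ps_monomial 1 0 0 + (a 0%nat 0%nat 3%nat *: ps_monomial 0 0 3
   + (a 0%nat 1%nat 2%nat *: ps_monomial 0 1 2 + (a 0%nat 2%nat 1%nat *: ps_monomial 0 2 1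
   + a 0%nat 3%nat 0%nat *: ps_monomial 0 3 0))))%ps.

Lemma curve_part1_spec (a : ps3) (i j k : nat) :
  (3 * i + j + k = 1)%nat -> ps_sub a (curve_part1 a) i j k = RtoC 0.
Proof.
  intro H. unfold ps_sub, curve_part1, ps_add, ps_scal, ps_monomial.
  destruct i as [|i]; [|lia].
  destruct j as [|[|j]]; [| |lia]; destruct k as [|[|k]]; try lia; cbn [Nat.eqb andb]; ring.
Qed.

Lemma curve_part3_spec (a : ps3) (i j k : nat) :
  (3 * i + j + k = 3)%nat -> ps_sub a (curve_part3 a) i j k = RtoC 0.
Proof.
  intro H. unfold ps_sub, curve_part3, ps_add, ps_scal, ps_monomial.
  destruct i as [|[|i]]; [| |lia];
  destruct j as [|[|[|[|j]]]]; try lia; destruct k as [|[|[|[|k]]]]; try lia;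
  cbn [Nat.eqb andb]; ring.
Qed.

Lemma coef_bound_curve_part1 (a : ps3) (r : R) :
  0 <= r -> exists B, coef_bound (curve_part1 a) r B.
Proof.
  intro Hr. eexists.
  apply coef_bound_add; [exact Hr| |]; apply coef_bound_scal, coef_bound_monomial, Hr.
Qed.

Lemma coef_bound_curve_part3 (a : ps3) (r : R) :
  0 <= r -> exists B, coef_bound (curve_part3 a) r B.
Proof.
  intro Hr. eexists.
  repeat (apply coef_bound_add; [exact Hr | apply coef_bound_scal, coef_bound_monomial, Hr|]).
  apply coef_bound_scal, coef_bound_monomial, Hr.
Qed.

Lemma zero_mean_scal (c : R) (g : R -> C) :
  zero_mean g -> zero_mean (fun th => (RtoC c * g th)%C).
Proof.
  intro H. unfold zero_mean. replace 0 with (scal c 0) at 2 by apply Rmult_0_r.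
  apply (is_RInt_ext (fun th => scal c (Re (g th)))).
  - intros th _. unfold scal; simpl. unfold mult; simpl. unfold Re. ring.
  - exact (is_RInt_scal _ _ _ c _ H).
Qed.

(** Conjugates of the curve's coordinates are multiples of conj(s)^3, conj(s), conj(s). The parts of
    the nu_i with matching powers of s contribute a real multiple of l, whose real part is 0; each
    remaining term falls under [zero_mean_eval_curve]. *)
Lemma radial_product_curve (nu1 nu2 nu3 : ps3) (l : C) (r B rho th : R) :
  0 < r -> coef_bound nu1 r B -> coef_bound nu2 r B -> coef_bound nu3 r B ->
  nu1 1%nat 0%nat 0%nat = (RtoC (/ 2) * l)%C ->
  (nu1 0%nat 0%nat 3%nat + RtoC 3 * nu1 0%nat 1%nat 2%nat + RtoC 9 * nu1 0%nat 2%nat 1%nat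
   + RtoC 27 * nu1 0%nat 3%nat 0%nat)%C = RtoC 0 ->
  nu2 0%nat 1%nat 0%nat = (RtoC (/ 3) * l)%C ->
  nu2 0%nat 0%nat 1%nat = (RtoC (- / 2) * l)%C ->
  nu3 0%nat 1%nat 0%nat = RtoC 0 ->
  nu3 0%nat 0%nat 1%nat = (RtoC (/ 6) * l)%C ->
  Re l = 0 -> 0 < rho <= 1 -> 3 * rho <= r / 4 ->
  let ev a := ps_eval a (curve1 rho th, curve2 rho th, curve3 rho th) in
  radial_product nu1 nu2 nu3 (curve1 rho th, curve2 rho th, curve3 rho th) =
  Re (RtoC 2 * (ev (ps_sub nu1 (curve_part3 nu1)) * (- Ci * Cconj (circle rho th) ^ 3)
       + ev (ps_sub nu2 (curve_part1 nu2)) * (RtoC 3 * Cconj (circle rho th) ^ 1)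
       + ev (ps_sub nu3 (curve_part1 nu3)) * (RtoC 1 * Cconj (circle rho th) ^ 1)))%C.
Proof.
  intros Hr B1 B2 B3 L1 L1' L21 L22 L31 L32 Hl Hrho Hsmall ev.
  destruct (curve_bounds rho th Hrho) as [M1 [M2 M3]].
  set (s := circle rho th).
  assert (HE := fun a Ha => proj1 (eval_approx a _ _ _ r B _ Hr Ha Hsmall M1 M2 M3)).
  assert (Hp3 : has_eval (curve_part3 nu1) (curve1 rho th) (curve2 rho th) (curve3 rho th)
                  (RtoC (/ 2) * l * (Ci * s ^ 3))%C).
  (* By [L1'] the cubic terms of [nu1] in x2, x3 cancel on the curve; they are added back to match
     [curve_part3]. *)
  { replace (RtoC (/ 2) * l * (Ci * s ^ 3))%C with
      (RtoC (/ 2) * l * (Ci * s ^ 3)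
       + (nu1 0%nat 0%nat 3%nat + RtoC 3 * nu1 0%nat 1%nat 2%nat
          + RtoC 9 * nu1 0%nat 2%nat 1%nat + RtoC 27 * nu1 0%nat 3%nat 0%nat) * s ^ 3)%C
      by (rewrite L1'; ring).
    replace (RtoC 9) with (RtoC 3 * RtoC 3)%C by (rewrite <- RtoC_mult; f_equal; lra).
    replace (RtoC 27) with (RtoC 3 * RtoC 3 * RtoC 3)%C
      by (rewrite <- !RtoC_mult; f_equal; lra).
    rewrite <- L1. unfold curve_part3.
    evar (z : C). match goal with |- has_eval _ _ _ _ ?x => replace x with z; subst z end.
    { has_eval_polynomial. }
    unfold curve1, curve2, curve3. fold s. ring. }
  assert (Hp1 : forall a, has_eval (curve_part1 a) (curve1 rho th) (curve2 rho th)
      (curve3 rho th) ((RtoC 3 * a 0%nat 1%nat 0%nat + a 0%nat 0%nat 1%nat) * s)%C).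
  { intro a. unfold curve_part1.
    evar (z : C). match goal with |- has_eval _ _ _ _ ?x => replace x with z; subst z end.
    { has_eval_polynomial. }
    unfold curve1, curve2, curve3. fold s. ring. }
  unfold ev.
  rewrite (has_eval_eq _ _ _ _ _ (has_eval_sub _ _ _ _ _ _ _ (HE nu1 B1) Hp3)).
  rewrite (has_eval_eq _ _ _ _ _ (has_eval_sub _ _ _ _ _ _ _ (HE nu2 B2) (Hp1 nu2))).
  rewrite (has_eval_eq _ _ _ _ _ (has_eval_sub _ _ _ _ _ _ _ (HE nu3 B3) (Hp1 nu3))).
  unfold radial_product. rewrite L21, L22, L31, L32.
  set (n1 := ps_eval nu1 _). set (n2 := ps_eval nu2 _). set (n3 := ps_eval nu3 _).
  unfold curve1, curve2, curve3. fold s.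
  assert (C1 : Cconj (Ci * s ^ 3) = (- Ci * Cconj s ^ 3)%C).
  { rewrite Cmult_conj, Cpow_conj. f_equal. unfold Ci, Cconj, Copp. simpl. f_equal; ring. }
  assert (C2 : Cconj (RtoC 3 * s) = (RtoC 3 * Cconj s)%C).
  { rewrite Cmult_conj. f_equal. unfold Cconj, RtoC. simpl. f_equal; ring. }
  rewrite C1, C2.
  assert (Q : (s * Cconj s)%C = RtoC (rho ^ 2)) by apply circle_mul_conj.
  set (main := (n1 * (- Ci * Cconj s ^ 3) + n2 * (RtoC 3 * Cconj s) + n3 * Cconj s)%C).
  (* The contributions of x1, x2 and x3 are rho^6/2, 3 (1 - 1/2) rho^2 and rho^2/6, each times l. *)
  set (R0 := rho ^ 6 / 2 + (3 / 2 + 1 / 6) * rho ^ 2).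
  match goal with |- _ = Re ?x => replace x with (RtoC 2 * main - RtoC (2 * R0) * l)%C end.
  - simpl. unfold Re in *. rewrite Hl. ring.
  - replace (RtoC (2 * R0)) with (RtoC 2 * (RtoC (/ 2) * (RtoC (rho ^ 2)) ^ 3
      + (RtoC 3 * RtoC (/ 3) + RtoC (- / 2)) * RtoC 3 * RtoC (rho ^ 2)
      + RtoC (/ 6) * RtoC (rho ^ 2)))%C.
    + rewrite <- Q. unfold main.
      replace (RtoC (/ 2) * (s * Cconj s) ^ 3)%C
        with (- (Ci * Ci) * RtoC (/ 2) * (s * Cconj s) ^ 3)%C by (rewrite Ci_sqr; ring).
      ring.
    + rewrite <- RtoC_pow, <- !RtoC_mult, <- !RtoC_plus, <- !RtoC_mult, <- !RtoC_plus,
        <- !RtoC_mult. f_equal. unfold R0. field.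
Qed.

Lemma radial_product_zero_curve (nu1 nu2 nu3 : ps3) (l : C) (r B eps0 : R) :
  0 < r -> coef_bound nu1 r B -> coef_bound nu2 r B -> coef_bound nu3 r B ->
  nu1 1%nat 0%nat 0%nat = (RtoC (/ 2) * l)%C ->
  (nu1 0%nat 0%nat 3%nat + RtoC 3 * nu1 0%nat 1%nat 2%nat + RtoC 9 * nu1 0%nat 2%nat 1%nat
   + RtoC 27 * nu1 0%nat 3%nat 0%nat)%C = RtoC 0 ->
  nu2 0%nat 1%nat 0%nat = (RtoC (/ 3) * l)%C ->
  nu2 0%nat 0%nat 1%nat = (RtoC (- / 2) * l)%C ->
  nu3 0%nat 1%nat 0%nat = RtoC 0 ->
  nu3 0%nat 0%nat 1%nat = (RtoC (/ 6) * l)%C ->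
  Re l = 0 -> 0 < eps0 ->
  exists P, hypersurface fD P /\ 0 < norm_sq P < eps0 ^ 2 /\
    radial_product nu1 nu2 nu3 P = 0.
Proof.
  intros Hr B1 B2 B3 L1 L1' L21 L22 L31 L32 Hl He.
  set (rho := Rmin 1 (Rmin (r / 12) (eps0 / 6))).
  assert (Hrho : 0 < rho <= 1 /\ 3 * rho <= r / 4 /\ rho <= eps0 / 6).
  { assert (m1 := Rmin_l 1 (Rmin (r / 12) (eps0 / 6))).
    assert (m2 := Rmin_r 1 (Rmin (r / 12) (eps0 / 6))).
    assert (m3 := Rmin_l (r / 12) (eps0 / 6)). assert (m4 := Rmin_r (r / 12) (eps0 / 6)).
    fold rho in m1, m2. repeat split; try lra. unfold rho. repeat apply Rmin_glb_lt; lra. }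
  destruct Hrho as [Hrho [Hsmall Heps]].
  set (F := fun th => radial_product nu1 nu2 nu3 (curve1 rho th, curve2 rho th, curve3 rho th)).
  destruct (is_RInt_zero_has_zero F) as [th Hth].
  - intro t.
    apply (radial_product_path_continuity nu1 nu2 nu3 (curve1 rho) (curve2 rho) (curve3 rho)
             r B (3 * rho) t (mkposreal 1 Rlt_0_1)); try assumption.
    + intros x _. now apply curve_bounds.
    + intros x _. apply curve_continuity.
  - destruct (coef_bound_curve_part3 nu1 r (Rlt_le _ _ Hr)) as [D1 HD1].
    destruct (coef_bound_curve_part1 nu2 r (Rlt_le _ _ Hr)) as [D2 HD2].
    destruct (coef_bound_curve_part1 nu3 r (Rlt_le _ _ Hr)) as [D3 HD3].
    assert (S1 := coef_bound_sub _ _ _ _ _ (Rlt_le _ _ Hr) B1 HD1).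
    assert (S2 := coef_bound_sub _ _ _ _ _ (Rlt_le _ _ Hr) B2 HD2).
    assert (S3 := coef_bound_sub _ _ _ _ _ (Rlt_le _ _ Hr) B3 HD3).
    eapply is_RInt_ext.
    { intros x _. symmetry. apply (radial_product_curve nu1 nu2 nu3 l r B rho x); assumption. }
    apply zero_mean_scal, zero_mean_plus; [apply zero_mean_plus|].
    + exact (zero_mean_eval_curve _ (- Ci) r _ rho 3 Hr S1 Hrho Hsmall (curve_part3_spec nu1)).
    + exact (zero_mean_eval_curve _ (RtoC 3) r _ rho 1 Hr S2 Hrho Hsmall (curve_part1_spec nu2)).
    + exact (zero_mean_eval_curve _ (RtoC 1) r _ rho 1 Hr S3 Hrho Hsmall (curve_part1_spec nu3)).
  - exists (curve1 rho th, curve2 rho th, curve3 rho th).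
    split; [apply curve_hypersurface|]. split; [split|exact Hth].
    + apply norm_sq_pos. apply Cmod_gt_0. unfold curve3. rewrite Cmod_circle; lra.
    + destruct (curve_bounds rho th Hrho) as [M1 [M2 M3]].
      eapply Rle_lt_trans; [apply (norm_sq_bound _ _ _ _ M1 M2 M3)|].
      replace (3 * (3 * rho) ^ 2) with (27 * rho ^ 2) by ring.
      apply Rle_lt_trans with (27 * (eps0 / 6) ^ 2).
      * apply Rmult_le_compat_l; [lra|]. apply pow_incr; lra.
      * assert (0 < eps0 ^ 2) by (apply pow_lt; lra).
        replace (27 * (eps0 / 6) ^ 2) with (27 / 36 * eps0 ^ 2) by field. lra.
Qed.

(** * Zeros of the radial product on arbitrarily small links *)

Lemma fD_radial_product_zero (nu1 nu2 nu3 : ps3) (eps0 : R) :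
  logarithmic fD nu1 nu2 nu3 -> 0 < eps0 ->
  exists P, hypersurface fD P /\ 0 < norm_sq P < eps0 ^ 2 /\
    radial_product nu1 nu2 nu3 P = 0.
Proof.
  intros [C1 [C2 [C3 [h [_ Hh]]]]] He.
  destruct (log_low_order nu1 nu2 nu3 h Hh)
    as [V1 [V2 [V3 [L1 [L1' [L21 [L22 [L31 L32]]]]]]]].
  destruct (convergent_coef_bound nu1 C1) as [r1 [b1 [R1 H1]]].
  destruct (convergent_coef_bound nu2 C2) as [r2 [b2 [R2 H2]]].
  destruct (convergent_coef_bound nu3 C3) as [r3 [b3 [R3 H3]]].
  set (r := Rmin r1 (Rmin r2 r3)). set (B := Rmax b1 (Rmax b2 b3)).
  assert (Hr : 0 < r) by (unfold r; repeat apply Rmin_glb_lt; assumption).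
  assert (Q1 := Rmin_l r1 (Rmin r2 r3)). assert (Q2 := Rmin_r r1 (Rmin r2 r3)).
  assert (Q3 := Rmin_l r2 r3). assert (Q4 := Rmin_r r2 r3).
  assert (T1 := Rmax_l b1 (Rmax b2 b3)). assert (T2 := Rmax_r b1 (Rmax b2 b3)).
  assert (T3 := Rmax_l b2 b3). assert (T4 := Rmax_r b2 b3).
  fold r in Q1, Q2. fold B in T1, T2.
  assert (B1 : coef_bound nu1 r B).
  { apply coef_bound_weaken with b1; [lra|]. apply coef_bound_le with r1; [lra | assumption]. }
  assert (B2 : coef_bound nu2 r B).
  { apply coef_bound_weaken with b2; [lra|]. apply coef_bound_le with r2; [lra | assumption]. }
  assert (B3 : coef_bound nu3 r B).
  { apply coef_bound_weaken with b3; [lra|]. apply coef_bound_le with r3; [lra | assumption]. }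
  destruct (Req_dec (Re (h 0%nat 0%nat 0%nat)) 0) as [E|E].
  - now apply (radial_product_zero_curve nu1 nu2 nu3 (h 0%nat 0%nat 0%nat) r B eps0).
  - now apply (radial_product_zero_real_path nu1 nu2 nu3 (h 0%nat 0%nat 0%nat) r B eps0).
Qed.

Theorem proposition8p2 :
  let f : ps3 := (X1 ^ 2 + (X2 - RtoC 3 *: X3) ^ 3 + X3 ^ 6)%ps in
  convergent f /\
  reduced f /\
  isolated_singularity f /\
  weighted_homogeneous_in X1 (X2 - RtoC 3 *: X3)%ps X3 f /\
  ~ (exists nu1 nu2 nu3 : ps3,
       logarithmic f nu1 nu2 nu3 /\
       exists eps0 : R, 0 < eps0 /\
         forall eps : R, 0 < eps < eps0 ->
         forall P : C * C * C, hypersurface f P -> sphere eps P ->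
           radial_product nu1 nu2 nu3 P <> 0).
Proof.
  intro f. change f with fD.
  split; [exact fD_convergent|]. split; [exact fD_reduced|].
  split; [exact fD_isolated|]. split; [exact fD_weighted_homogeneous_in|].
  intros [nu1 [nu2 [nu3 [Hlog [eps0 [He H]]]]]].
  destruct (fD_radial_product_zero nu1 nu2 nu3 eps0 Hlog He) as [P [HP [HN HR]]].
  (* The zero P lies on the link of radius |P|, which is positive and less than eps0. *)
  apply (H (sqrt (norm_sq P))) with P; try assumption.
  - split; [apply sqrt_lt_R0; lra|].
    rewrite <- (sqrt_pow2 eps0) by lra. apply sqrt_lt_1_alt. lra.
  - unfold sphere. rewrite pow2_sqrt; lra.
Qed.
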